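(* Let $p\ge1$ and let $\mathbf X$ be a random variable with values in $\mathcal R^w_p(V)$ such that $\mathbb E|\langle\mathbf X_{0,T},f\rangle|<\infty$ for every $f\in T(V)$. Then: 1. (compensated moments) For every $k\ge1$ and nonempty words $\tau_1,\dots,\tau_k\in[d]^*$, with $\boldsymbol\tau=(\tau_1,\dots,\tau_k)$, $$\langle\kappa_{\mathbf X},e_{\tau_1}\sqcup\cdots\sqcup e_{\tau_k}\rangle=\sum_{\mathbf a\in\mathrm{Orp}(\boldsymbol\tau)}(-1)^{|\mathbf a|-1}\frac{\mathbf a!}{|\mathbf a|}\mu_{\mathbf X}(\mathbf a).$$ 2. (moment bijection) For every nonempty word $\tau\in[d]^*$, $$\langle\mu_{\mathbf X},e_\tau\rangle=\sum_{\mathbf a\in\mathrm{Orp}(\tau)}\frac{1}{|\mathbf a|!}\prod_{B\in\mathbf a}\langle\kappa_{\mathbf X},e_B\rangle,$$ where $\mathrm{Orp}(\tau)$ is the set of partitions of the positions of $\tau$ into intervals of consecutive positions and $e_B=e_{\tau(p_1)}\otimes\cdots\otimes e_{\tau(p_r)}$ for a block $B=\{p_1<\dots<p_r\}$. 3. (independence) Let $I,J\subseteq[d]$ and suppose the joint law of $(\mathbf X|_I,\mathbf X|_J)$ is determined by the mixed moments $\{\mathbb E[\langle\mathbf X_{0,T},e_{\tau_1}\rangle\langle\mathbf X_{0,T},e_{\tau_2}\rangle]:\tau_1\in I^*\cup\{()\},\tau_2\in J^*\cup\{()\}\}$, in the sense that any pair of random variables with values in $\mathbb R^{I^*}\times\mathbb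 R^{J^*}$ having the same (finite) mixed moments of this form has the same joint law. Then $\mathbf X|_I$ and $\mathbf X|_J$ are independent if and only if $\langle\kappa_{\mathbf X},e_{\tau_1}\sqcup e_{\tau_2}\rangle=0$ for all $\tau_1\in I^*$, $\tau_2\in J^*$.
   Context: Let $V=\mathbb R^d$ with basis $e_1,\dots,e_d$; $[n]=\{1,\dots,n\}$; $[d]^*=\bigcup_{m\ge0}[d]^m$ words, $|\tau|$ length, $e_\tau=e_{i_1}\otimes\cdots\otimes e_{i_m}$, $e_{()}=1$; for $I\subseteq[d]$, $I^*$ is the set of nonempty words with letters in $I$. $T(V)=\bigoplus_mV^{\otimes m}$, $T((V))=\prod_mV^{\otimes m}$ (algebra under $\otimes$), pairing $\langle s,t\rangle=\sum_\tau s_\tau t_\tau$; $\log y=\sum_{n\ge1}\frac{(-1)^{n-1}}{n}(y-1)^{\otimes n}$ for $\langle y,1\rangle=1$. Shuffle $\sqcup$: bilinear extension of $e_{\tau_1}\sqcup e_{\tau_2}=\sum_\sigma e_\sigma$ over interleavings counted with multiplicity. Weakly geometric $p$-rough paths (on some interval $[0,T]$): maps $\mathbf x:\{0\le s\le t\le T\}\to T((V))$ with (i) $\langle\mathbf x_{s,t},1\rangle=1$, $\langle\mathbf x_{s,t},f\sqcup g\rangle=\langle\mathbf x_{s,t},f\rangle\langle\mathbf x_{s,t},g\rangle$ for $f,g\in T(V)$; (ii) $\mathbf x_{s,t}\otimes\mathbf x_{t,u}=\mathbf x_{s,u}$; (iii) $\max_{1\le m\le p}\sup_D(\sum_i|\pi_m\mathbf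 x_{t_i,t_{i+1}}|^{p/m})^{1/p}<\infty$. $\mathcal G^w_p(V)$ is the set of these; $\mathbf x_{0,T}$ is the signature. A continuous path $z:[0,S]\to E$ ($E$ a topological space) is tree-like if $z=\psi\circ\varphi$ for some $\mathbb R$-tree $\mathcal T$, continuous $\varphi:[0,S]\to\mathcal T$ with $\varphi(0)=\varphi(S)$ and map $\psi:\mathcal T\to E$. Two weakly geometric rough paths $\mathbf x$ (on $[0,T]$) and $\mathbf y$ (on $[0,S]$) are tree-like equivalent if the path obtained by running $t\mapsto\mathbf x_{0,t}$ and then the time-reversal of $s\mapsto\mathbf y_{0,s}$, left-translated to start at $\mathbf x_{0,T}$, is tree-like. $\mathcal R^w_p(V)$ is the quotient of $\mathcal G^w_p(V)$ by this equivalence (unparametrised rough paths), topologised via $\mathbf x\mapsto\mathbf x_{0,T}$; the signature $\mathbf X_{0,T}$ is well defined on classes. $\mu_{\mathbf X}=\mathbb E[\mathbf X_{0,T}]$, $\kappa_{\mathbf X}=\log\mu_{\mathbf X}$. $\mathbf X|_I$ denotes the $\mathbb R^{I^*}$-valued random variable $(\langle\mathbf X_{0,T},e_\tau\rangle)_{\tau\in I^*}$ (product $\sigma$-algebra). Ordered partitions: for a finite poset $P$, partitions into nonempty blocks with refinement order, $|\mathbf a|$ the number of blocks; $\mathrm{Orp}(P)=\{\ker f:f:P\to\mathbb N\text{ order-preserving}\}$ ($\ker f$ = nonempty fibres; order-preserving: $x\le y\Rightarrow f(x)\le f(y)$); $\mathbf a!=\#\{f:P\to[|\mathbf a|]\text{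 order-preserving}:\ker f=\mathbf a\}$. Word poset $P_{\boldsymbol\tau}=\{(j,p):j\in[k],p\in[|\tau_j|]\}$ with $(j,p)\le(j',p')$ iff $j=j'$ and $p\le p'$ (positions distinct even if letters repeat); $\mathrm{Orp}(\boldsymbol\tau)=\mathrm{Orp}(P_{\boldsymbol\tau})$. For a block $B$, $B^j=B\cap(\{j\}\times[|\tau_j|])$, $e_{B^j}=e_{\tau_j(p_1)}\otimes\cdots\otimes e_{\tau_j(p_r)}$ for its positions $p_1<\dots<p_r$ ($\tau_j(p)$ the $p$-th letter). Generalised moment $\mu_{\mathbf X}(\mathbf a)=\prod_{B\in\mathbf a}\mathbb E[\prod_{j:B^j\neq\emptyset}\langle\mathbf X_{0,T},e_{B^j}\rangle]$. *)

(* Defs.v *)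
From HB Require Import structures.
From mathcomp Require Import all_boot all_order all_algebra.
From mathcomp Require Import all_classical all_reals all_analysis.

Set Implicit Arguments.
Unset Strict Implicit.
Unset Printing Implicit Defensive.

Import Order.TTheory GRing.Theory Num.Theory.
Local Open Scope classical_set_scope.
Local Open Scope ring_scope.

Definition word (d : nat) := seq 'I_d.

Fixpoint shuffle {T : Type} (u v : seq T) {struct u} : seq (seq T) :=
  match u with
  | [::] => [:: v]
  | a :: u' =>
    let fix sh_v (v : seq T) : seq (seq T) :=
      match v with
      | [::] => [:: u]
      | b :: v' => map (cons a) (shuffle u' v) ++ map (cons b) (sh_v v')
      end
    in sh_v v
  end.

Definition shuffle_all {T : Type} (ts : seq (seq T)) : seq (seq T) :=
  foldr (fun t acc => flatten [seq shuffle t w | w <- acc]) [:: [::]] ts.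

Section Tensors.
Variables (R : realType) (d : nat).

Definition tseries := word d -> R.

(* T(V) : finite linear combinations  sum_i c_i e_{w_i}  *)
Definition tensor := seq (word d * R).

Definition pairing (s : tseries) (f : tensor) : R :=
  \sum_(x <- f) x.2 * s x.1.

Definition tshuffle (f g : tensor) : tensor :=
  flatten [seq [seq (w, x.2 * y.2) | w <- shuffle x.1 y.1] | x <- f, y <- g].

Definition tone : tseries := fun w => (w == [::])%:R.

Definition tmul (s t : tseries) : tseries :=
  fun w => \sum_(i < (size w).+1) s (take i w) * t (drop i w).

Fixpoint tpow (s : tseries) (n : nat) : tseries :=
  if n is n'.+1 then tmul s (tpow s n') else tone.

(* log y = sum_{n>=1} (-1)^(n-1)/n (y-1)^{⊗ n}, for <y,1> = 1.  Since
   (y-1) has zero constant term, the coefficient of (y-1)^{⊗ n} at a word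
   w vanishes when n > |w|, so the coefficient at w is the finite sum
   below (exact, not a truncation, when <y,1> = 1). *)
Definition tlog (y : tseries) : tseries :=
  fun w => \sum_(1 <= n < (size w).+1)
             ((-1) ^+ n.-1 / n%:R) * tpow (fun v => y v - tone v) n w.

Definition tnorm (m : nat) (y : tseries) : R :=
  Num.sqrt (\sum_(w : m.-tuple 'I_d) (y (tval w)) ^+ 2).

End Tensors.

Section RoughPaths.
Variables (R : realType) (d : nat) (p : R).

Definition finite_pvar (T : R) (x : R -> R -> tseries R d) : Prop :=
  forall m : nat, (1 <= m)%N -> m%:R <= p ->
  exists C : R, forall (n : nat) (t : nat -> R),
    t 0%N = 0 -> t n = T -> (forall i, (i < n)%N -> t i < t i.+1) ->
    \sum_(i < n) (tnorm m (x (t i) (t i.+1))) `^ (p / m%:R) <= C.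

Record roughpath := RoughPath {
  rp_T : R;
  rp_x : R -> R -> tseries R d;
  rp_T_ge0 : 0 <= rp_T;
  rp_one : forall s t, 0 <= s -> s <= t -> t <= rp_T -> rp_x s t [::] = 1;
  rp_char : forall s t, 0 <= s -> s <= t -> t <= rp_T ->
    forall f g : tensor R d,
      pairing (rp_x s t) (tshuffle f g) =
      pairing (rp_x s t) f * pairing (rp_x s t) g;
  rp_chen : forall s t u, 0 <= s -> s <= t -> t <= u -> u <= rp_T ->
    tmul (rp_x s t) (rp_x t u) = rp_x s u;
  rp_pvar : finite_pvar rp_T rp_x
}.

Definition signature (x : roughpath) : tseries R d := rp_x x 0 (rp_T x).

End RoughPaths.

Section OrderedPartitions.
Variables (d k : nat) (tau : 'I_k -> word d).

Definition Ptau : finType := {j : 'I_k & 'I_(size (tau j))}.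

Definition pos_le (x y : Ptau) : bool :=
  (tag x == tag y) && (nat_of_ord (tagged x) <= nat_of_ord (tagged y))%N.

Definition kerset {U : eqType} (f : Ptau -> U) : {set {set Ptau}} :=
  ([set [set y | f y == f x] | x : Ptau])%SET.

Definition Orp : {set {set {set Ptau}}} :=
  ([set a | `[< exists f : Ptau -> nat,
               (forall x y, pos_le x y -> (f x <= f y)%N) /\ a = kerset f >] ])%SET.

Definition ofact (a : {set {set Ptau}}) : nat :=
  #|([set g : {ffun Ptau -> 'I_#|a|} |
      [forall x, forall y, pos_le x y ==> (nat_of_ord (g x) <= nat_of_ord (g y))%N]
      && (kerset g == a)])%SET|.

(* e_{B^j}: the letters of tau_j at the positions of B^j, in increasing
   order (the empty word iff B^j is empty) *)
Definition blockword (B : {set Ptau}) (j : 'I_k) : word d :=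
  [seq tnth (in_tuple (tau j)) q | q <- enum 'I_(size (tau j)) &
                                   Tagged (fun j => 'I_(size (tau j))) q \in B].

End OrderedPartitions.

Section Moments.
Variables (R : realType) (d : nat) (dO : measure_display) (Omega : measurableType dO)
          (P : probability Omega R) (S : Omega -> tseries R d).

Definition Ex (f : Omega -> R) : R := fine (\int[P]_w (f w)%:E).

Definition exp_sig : tseries R d := fun w => Ex (fun om => S om w).

Definition sig_cumulant : tseries R d := tlog exp_sig.

Definition gen_moment k (tau : 'I_k -> word d) (a : {set {set Ptau tau}}) : R :=
  \prod_(B in a)
     Ex (fun om => \prod_(j < k | blockword B j != [::]) S om (blockword B j)).

End Moments.

Section Restrictions.
Variables (R : realType) (d : nat).

Definition in_star (I : {set 'I_d}) (w : word d) : bool :=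
  (w != [::]) && all (fun i => i \in I) w.

Definition in_star0 (I : {set 'I_d}) (w : word d) : bool :=
  all (fun i => i \in I) w.

(* product sigma-algebra on R^{I^*}, realised on functions word -> R
   (only the coordinates in I^* are seen) *)
Definition cyl_sigma (I : {set 'I_d}) : set (set (tseries R d)) :=
  <<s [set C | exists w A, in_star I w /\ measurable A /\
                           C = [set y | A (y w)]] >>.

Definition cyl_sigma2 (I J : {set 'I_d}) :
    set (set (tseries R d * tseries R d)) :=
  <<s [set C | exists w A, measurable A /\
         ((in_star I w /\ C = [set yz | A (yz.1 w)]) \/
          (in_star J w /\ C = [set yz | A (yz.2 w)]))] >>.

(* the coordinate "Y_tau" of an R^{I^*}-valued variable, with Y_() = 1 *)
Definition coord1 (y : tseries R d) (w : word d) : R :=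
  if w == [::] then 1 else y w.

End Restrictions.

Definition indep_restr (R : realType) (d : nat) (dO : measure_display)
  (Omega : measurableType dO) (P : probability Omega R)
  (S : Omega -> tseries R d) (I J : {set 'I_d}) : Prop :=
  forall A B, cyl_sigma I A -> cyl_sigma J B ->
    P ((S @^-1` A) `&` (S @^-1` B)) = (P (S @^-1` A) * P (S @^-1` B))%E.

Definition law_det_by_mixed_moments (R : realType) (d : nat)
  (dO : measure_display) (Omega : measurableType dO) (P : probability Omega R)
  (S : Omega -> tseries R d) (I J : {set 'I_d}) : Prop :=
  forall (dO' : measure_display) (Omega' : measurableType dO')
         (P' : probability Omega' R) (Y Z : Omega' -> tseries R d),
    (forall w, in_star I w -> measurable_fun setT (fun om => Y om w)) ->
    (forall w, in_star J w -> measurable_fun setT (fun om => Z om w)) ->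
    (forall w1 w2, in_star0 I w1 -> in_star0 J w2 ->
       P'.-integrable setT (fun om => (coord1 (Y om) w1 * coord1 (Z om) w2)%:E) /\
       (\int[P']_om (coord1 (Y om) w1 * coord1 (Z om) w2)%:E)%E =
       (\int[P]_om (S om w1 * S om w2)%:E)%E) ->
    forall C, cyl_sigma2 I J C ->
      P' ((fun om => (Y om, Z om)) @^-1` C) = P ((fun om => (S om, S om)) @^-1` C).

(* Main.v *)
(* Pairing with shuffles turns deconcatenation into cutting a tuple of words at a
   lower set of the poset of positions, so the n-th convolution power of a series,
   paired with a shuffle, is a sum over order-preserving maps to an n-element
   chain.  Grouping these maps by their kernels and using the shuffle identity of
   each signature gives the compensated moments.  Since [exp (log mu) = mu], the
   same expansion for a single word, whose positions form a chain, gives the moment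
   bijection.  For independence: if the mixed cumulants on pairs [(u, v)] vanish,
   the convolution powers of [kappa] obey the binomial formula on pairs, whence
   [mu] paired with [u] shuffle [v] equals [mu u * mu v]; conversely, by induction
   on the total length, the defect of this factorisation is exactly the mixed
   cumulant.  Factorisation of mixed moments means that they agree with those of
   two independent copies, so determinacy by moments identifies the joint laws. *)
Require Import Defs.
From HB Require Import structures.
From mathcomp Require Import all_boot all_order all_algebra.
From mathcomp Require Import all_classical all_reals all_analysis.
From mathcomp Require Import measurable_realfun zify ring.
Import Order.TTheory GRing.Theory Num.Theory.
Local Open Scope classical_set_scope.
Local Open Scope ring_scope.

(** * Shuffles of words whose letters reveal the word they come from *)

Section Shuffles.
Set Implicit Arguments.
Unset Strict Implicit.

Local Arguments shuffle : simpl never.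

Lemma shuffle_nill (T : Type) (v : seq T) : shuffle [::] v = [:: v].
Proof. by []. Qed.

Lemma shuffle_nilr (T : Type) (u : seq T) : shuffle u [::] = [:: u].
Proof. by case: u. Qed.

Lemma shuffle_cons (T : Type) (a b : T) (u v : seq T) :
  shuffle (a :: u) (b :: v) =
  map (cons a) (shuffle u (b :: v)) ++ map (cons b) (shuffle (a :: u) v).
Proof. by []. Qed.

Lemma map_shuffle (T T' : Type) (f : T -> T') (u v : seq T) :
  [seq map f z | z <- shuffle u v] = shuffle (map f u) (map f v).
Proof.
elim: u v => [|a u IHu] //; elim=> [|b v IHv] //.
rewrite !map_cons !shuffle_cons map_cat -!map_comp -map_cons -IHu.
by rewrite -map_cons -IHv -!map_comp.
Qed.

Lemma map_shuffle_all (T T' : Type) (f : T -> T') (ts : seq (seq T)) :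
  [seq map f z | z <- shuffle_all ts] = shuffle_all [seq map f t | t <- ts].
Proof.
elim: ts => //= t ts <-; rewrite map_flatten -!map_comp.
by congr flatten; apply: eq_map => w /=; rewrite map_shuffle.
Qed.

Lemma mem_map_cons (T : eqType) (a c : T) (z : seq T) (s : seq (seq T)) :
  (c :: z \in map (cons a) s) = (c == a) && (z \in s).
Proof.
apply/mapP/andP => [[w ws [-> ->]]|[/eqP-> zs]]; first by rewrite eqxx.
by exists z.
Qed.

Lemma filter_eq_nil (T : eqType) (p : pred T) (z : seq T) :
  (seq.filter p z == [::]) = all (predC p) z.
Proof. by rewrite all_predC has_filter negbK. Qed.

(** Since [p] tells the letters of [u] from those of [v], the head of [z] decides which branch of
    the shuffle recursion it lies in, and both words are recovered by filtering. *)
Lemma mem_shuffle (T : eqType) (p : pred T) (u v z : seq T) :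
  all p u -> all (predC p) v ->
  (z \in shuffle u v) = (seq.filter p z == u) && (seq.filter (predC p) z == v).
Proof.
elim: u v z => [|a u IHu] v z.
  move=> _ pv; rewrite shuffle_nill mem_seq1 filter_eq_nil; apply/eqP/andP => [->|[]].
    by rewrite (all_filterP pv).
  by move=> /all_filterP-> /eqP.
elim: v z => [|b v IHv] z.
  have allpp (y : seq T) : all (predC (predC p)) y = all p y.
    by apply: eq_all => x /=; rewrite negbK.
  move=> pau _; rewrite shuffle_nilr mem_seq1 filter_eq_nil allpp.
  apply/eqP/andP => [->|[/eqP <-]]; first by rewrite (all_filterP pau).
  by move=> /all_filterP->.
move=> pau pbv; have /andP[pa pu] := pau; have /andP[/= pb pv] := pbv.
rewrite shuffle_cons mem_cat; case: z => [|c z].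
  by apply/negbTE; rewrite negb_or; apply/andP; split; apply/mapP => -[].
rewrite !mem_map_cons (IHu _ _ pu pbv) (IHv _ pau pv) /=.
case: ifP => pc /=.
  rewrite eqseq_cons; have /negbTE-> : c != b by apply: contraNneq pb => <-.
  by rewrite orbF andbA.
rewrite eqseq_cons; have /negbTE-> : c != a by apply: contraFneq pc => ->.
by rewrite /= andbCA.
Qed.

Lemma shuffle_uniq (T : eqType) (p : pred T) (u v : seq T) :
  all p u -> all (predC p) v -> uniq (shuffle u v).
Proof.
elim: u v => [|a u IHu] //; elim=> [|b v IHv] //.
move=> pau pbv; have /andP[pa pu] := pau; have /andP[/= pb pv] := pbv.
have consI (c : T) : injective (cons c) by move=> ? ? [].
rewrite cat_uniq !(map_inj_uniq (consI _)) (IHu _ pu pbv) (IHv pau pv) andbT /=.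
apply/hasPn => z /mapP[w _ ->]; rewrite mem_map_cons negb_and.
by apply/orP; left; apply: contraNneq pb => ->.
Qed.

Lemma shuffle_flatten_uniq (T : eqType) (p : pred T) (u : seq T)
    (vs : seq (seq T)) :
  all p u -> uniq vs -> {in vs, forall v, all (predC p) v} ->
  uniq (flatten [seq shuffle u v | v <- vs]).
Proof.
move=> pu; elim: vs => //= v vs IH /andP[vvs uvs] pvs.
have pv : all (predC p) v by apply: pvs; rewrite mem_head.
have pvs' : {in vs, forall w, all (predC p) w}.
  by move=> w wvs; apply: pvs; rewrite inE wvs orbT.
rewrite cat_uniq (shuffle_uniq pu pv) IH ?andbT //=.
apply/hasPn => z /flattenP[_ /mapP[w wvs ->]].
rewrite (mem_shuffle _ pu (pvs' _ wvs)) (mem_shuffle _ pu pv).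
case/andP=> _ /eqP->; rewrite negb_and; apply/orP; right.
by apply: contraNneq vvs => <-.
Qed.

(** Here [g] maps a letter to the index of its word. As [s] has no repetition, the shuffle of the
    remaining words has no letter of index [j], so [mem_shuffle] applies to the predicate [g x == j]
    at each step. *)
Lemma mem_shuffle_all (T I : eqType) (g : T -> I) (c : I -> seq T)
    (s : seq I) (z : seq T) :
  uniq s -> (forall j, all (fun x => g x == j) (c j)) ->
  (z \in shuffle_all [seq c j | j <- s]) =
  all (fun x => g x \in s) z && all (fun j => [seq x <- z | g x == j] == c j) s.
Proof.
move=> us gc; elim: s us z => [_|j s IH /= /andP[js us]] z.
  by rewrite /= mem_seq1 andbT; case: z.
have notj w : w \in shuffle_all [seq c j | j <- s] ->
    all (predC (fun x => g x == j)) w.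
  rewrite IH // => /andP[/allP gs _]; apply/allP => x /gs gx /=.
  by apply: contraNneq js => <-.
apply/flattenP/andP => [[_ /mapP[w ws ->]]|[/allP gz /andP[zj /allP zs]]].
  rewrite (mem_shuffle _ (gc j) (notj _ ws)) => /andP[zj /eqP zw].
  move: ws; rewrite IH // -zw => /andP[gs cs]; split.
    apply/allP => x xz; rewrite inE; case: (boolP (g x == j)) => //= gxj.
    by move/allP: gs; apply; rewrite mem_filter /= gxj.
  rewrite zj /=; apply/allP => i si; move/allP: cs => /(_ _ si).
  rewrite -filter_predI; move=> /eqP <-; apply/eqP; apply: eq_filter => x /=.
  by case: eqP => //= ->; apply/esym; apply: contraNneq js => <-.
have fs : [seq x <- z | predC (fun x => g x == j) x]
    \in shuffle_all [seq c j | j <- s].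
  rewrite IH //; apply/andP; split.
    apply/allP => x; rewrite mem_filter => /andP[/= gxj /gz].
    by rewrite inE (negbTE gxj).
  apply/allP => i si; rewrite -filter_predI; move/eqP: (zs _ si) => <-.
  apply/eqP; apply: eq_filter => x /=.
  by case: eqP => //= ->; apply: contraNneq js => <-.
eexists; first by apply: map_f; exact: fs.
by rewrite (mem_shuffle _ (gc j) (notj _ fs)) zj eqxx.
Qed.

Lemma shuffle_all_uniq (T I : eqType) (g : T -> I) (c : I -> seq T)
    (s : seq I) :
  uniq s -> (forall j, all (fun x => g x == j) (c j)) ->
  uniq (shuffle_all [seq c j | j <- s]).
Proof.
move=> us gc; elim: s us => //= j s IH /andP[js us].
apply: (shuffle_flatten_uniq (p := fun x => g x == j)) => //; first exact: IH.
move=> w; rewrite (mem_shuffle_all _ us gc) => /andP[/allP gs _].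
by apply/allP => x /gs gx /=; apply: contraNneq js => <-.
Qed.

End Shuffles.

(** * Linear extensions of sets of positions, and their cuts *)

Section PositionSets.
Set Implicit Arguments.
Unset Strict Implicit.
Variables (d k : nat) (tau : 'I_k -> word d).
Implicit Types (B D : {set Ptau tau}) (j : 'I_k) (x y : Ptau tau).

Definition letter x : 'I_d := tnth (in_tuple (tau (tag x))) (tagged x).

Definition full_chain j : seq (Ptau tau) :=
  [seq Tagged (fun j => 'I_(size (tau j))) q | q <- enum 'I_(size (tau j))].

Definition chain D j : seq (Ptau tau) := [seq x <- full_chain j | x \in D].

(* The linear extensions of the induced order on [D], as sequences of positions. *)
Definition linext D : seq (seq (Ptau tau)) :=
  shuffle_all [seq chain D j | j <- enum 'I_k].

(** A lower set of [D], stated as a cut of every chain because cutting a linear extension produces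
    it in this form; [lower_partE] gives the order-theoretic form. *)
Definition lower_part B D : bool :=
  (B \subset D) &&
  [forall j, chain D j == chain B j ++ chain (D :\: B)%SET j].

Lemma mem_full_chain j x : (x \in full_chain j) = (tag x == j).
Proof.
apply/mapP/eqP => [[q _ ->]|<-] //; exists (tagged x); first exact: mem_enum.
by case: x.
Qed.

Lemma full_chain_uniq j : uniq (full_chain j).
Proof.
rewrite map_inj_uniq ?enum_uniq // => q1 q2 /eqP.
by rewrite eq_Tagged /= => /eqP.
Qed.

Lemma mem_chain D j x : (x \in chain D j) = (x \in D) && (tag x == j).
Proof. by rewrite mem_filter mem_full_chain. Qed.

Lemma blockwordE D j : blockword D j = [seq letter x | x <- chain D j].
Proof.
by rewrite /blockword /chain /full_chain [in RHS]filter_map -[RHS]map_comp.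
Qed.

Lemma chain_tag D j : all (fun x => tag x == j) (chain D j).
Proof. by apply/allP => x; rewrite mem_chain => /andP[]. Qed.

Lemma mem_linext D z :
  (z \in linext D) = [forall j, [seq x <- z | tag x == j] == chain D j].
Proof.
rewrite (mem_shuffle_all _ (enum_uniq _) (chain_tag D)).
have -> : all (fun x => tag x \in enum 'I_k) z.
  by apply/allP => x _; rewrite mem_enum.
apply/allP/forallP => h j; first by apply: h; rewrite mem_enum.
by move=> _; apply: h.
Qed.

Lemma linext_uniq D : uniq (linext D).
Proof. exact: (shuffle_all_uniq (enum_uniq _) (chain_tag D)). Qed.

Lemma linext_mem D z : z \in linext D -> z =i D.
Proof.
rewrite mem_linext => /forallP zD x.
have := mem_chain D (tag x) x.
by rewrite -(eqP (zD (tag x))) mem_filter eqxx andbT.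
Qed.

Lemma linext_elt_uniq D z : z \in linext D -> uniq z.
Proof.
move=> zl; apply: count_mem_uniq => x; rewrite (linext_mem zl).
move: zl; rewrite mem_linext => /forallP/(_ (tag x))/eqP zx.
have : uniq (chain D (tag x)) by rewrite filter_uniq ?full_chain_uniq.
move/count_uniq_mem => /(_ x); rewrite mem_chain eqxx andbT -zx => <-.
rewrite count_filter; apply: eq_count => y /=; case: eqP => // ->; by rewrite eqxx.
Qed.

Lemma linext_size D z : z \in linext D -> size z = #|D|.
Proof.
move=> zl; rewrite -(card_uniqP (linext_elt_uniq zl)).
by apply: eq_card => x; rewrite (linext_mem zl).
Qed.

(** Positions are distinct even where letters repeat, so the multiplicities of a shuffle of words
    become distinct entries of the duplicate-free [linext D]. *)
Lemma linext_letters D :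
  shuffle_all [seq blockword D j | j <- enum 'I_k] =
  [seq [seq letter x | x <- z] | z <- linext D].
Proof.
rewrite map_shuffle_all -map_comp; congr shuffle_all.
by apply: eq_map => j /=; rewrite blockwordE.
Qed.

Lemma blockword_setT j : blockword [set: Ptau tau]%SET j = tau j.
Proof.
rewrite /blockword (eq_filter (a2 := predT)) ?filter_predT; last first.
  by move=> q; rewrite inE.
by rewrite -[RHS]/(tval (in_tuple (tau j))) -map_tnth_enum.
Qed.

Lemma linext_cat B D z1 z2 :
  lower_part B D -> z1 \in linext B -> z2 \in linext (D :\: B)%SET -> z1 ++ z2 \in linext D.
Proof.
move=> /andP[_ /forallP dB]; rewrite !mem_linext => /forallP h1 /forallP h2.
apply/forallP => j; rewrite filter_cat (eqP (h1 j)) (eqP (h2 j)).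
by rewrite eq_sym.
Qed.

Lemma linext_split D z i : z \in linext D ->
  let B := [set x in take i z]%SET in
  [/\ lower_part B D, take i z \in linext B & drop i z \in linext (D :\: B)%SET].
Proof.
move=> zD B; have uz := linext_elt_uniq zD; have mz := linext_mem zD.
have BD : B \subset D.
  by apply/fintype.subsetP => x; rewrite inE => /mem_take; rewrite mz.
(* [z] has no repetition, so the suffix avoids the set [B] of entries of the prefix; filtering a
   chain of [D] by [B] then isolates the prefix. *)
have disj x : x \in drop i z -> x \notin B.
  move=> xd; rewrite inE; move: uz; rewrite -{1}(cat_take_drop i z) cat_uniq.
  by case/and3P => _ /hasPn/(_ _ xd).
have h j : [seq x <- z | tag x == j] = chain D j.
  by move: zD; rewrite mem_linext => /forallP/(_ j)/eqP.
have zcat j : chain D j = [seq x <- take i z | tag x == j] ++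
                          [seq x <- drop i z | tag x == j].
  by rewrite -h -filter_cat cat_take_drop.
have tB : {in take i z, forall x, x \in B} by move=> x; rewrite inE.
have chB j : chain B j = [seq x <- take i z | tag x == j].
  transitivity [seq x <- chain D j | x \in B].
    rewrite /chain -filter_predI; apply: eq_filter => x /=.
    by case: (boolP (x \in B)) => // /(fintype.subsetP BD) ->.
  rewrite zcat filter_cat [X in X ++ _](_ : _ = [seq x <- take i z | tag x == j]).
    rewrite [X in _ ++ X](_ : _ = [::]) ?cats0 //; apply/eqP.
    rewrite filter_eq_nil; apply/allP => x; rewrite mem_filter => /andP[_ xd].
    exact: disj.
  by apply/all_filterP/allP => x; rewrite mem_filter => /andP[_ /tB].
have chDB j : chain (D :\: B)%SET j = [seq x <- drop i z | tag x == j].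
  transitivity [seq x <- chain D j | x \notin B].
    rewrite /chain -filter_predI; apply: eq_filter => x /=.
    by rewrite !inE.
  rewrite zcat filter_cat [X in X ++ _](_ : _ = [::]).
    apply/all_filterP/allP => x; rewrite mem_filter => /andP[_ xd].
    exact: disj.
  apply/eqP; rewrite filter_eq_nil; apply/allP => x.
  by rewrite mem_filter => /andP[_ /tB] /=; rewrite negbK.
split; last 2 first.
- by rewrite mem_linext; apply/forallP => j; rewrite chB.
- by rewrite mem_linext; apply/forallP => j; rewrite chDB.
by rewrite /lower_part BD; apply/forallP => j; rewrite chB chDB zcat.
Qed.

(** Cutting a linear extension of [D] is inverse to choosing a lower part [B] and concatenating
    linear extensions of [B] and of its complement. Both sums are written over duplicate-free lists
    of pairs (prefix, suffix) with the same members. *)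
Lemma sum_linext_split (R : nmodType) (F : seq (Ptau tau) -> seq (Ptau tau) -> R) D :
  \sum_(z <- linext D) \sum_(i < (size z).+1) F (take i z) (drop i z) =
  \sum_(B | lower_part B D) \sum_(z1 <- linext B) \sum_(z2 <- linext (D :\: B)%SET) F z1 z2.
Proof.
pose l1 := [seq (take i z, drop i z) | z <- linext D, i <- iota 0 (size z).+1].
pose pairs B := [seq (z1, z2) | z1 <- linext B, z2 <- linext (D :\: B)%SET].
pose l2 := [seq q | B <- enum [pred B | lower_part B D], q <- pairs B].
transitivity (\sum_(q <- l1) F q.1 q.2).
  rewrite big_allpairs_dep; apply: eq_bigr => z _.
  have -> : iota 0 (size z).+1 = index_iota 0 (size z).+1.
    by rewrite /index_iota subn0.
  by rewrite big_mkord.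
transitivity (\sum_(q <- l2) F q.1 q.2); last first.
  rewrite big_allpairs_dep big_enum /=; apply: eq_bigr => B _.
  by rewrite big_allpairs_dep.
apply: perm_big; apply: uniq_perm.
- apply: allpairs_uniq_dep => [|z _|]; [exact: linext_uniq|exact: iota_uniq|].
  move=> _ _ /allpairsPdep[z [i [zl il ->]]] /allpairsPdep[w [j [wl jl ->]]] /=.
  case=> tE dE; have zw : z = w.
    by rewrite -(cat_take_drop i z) tE dE cat_take_drop.
  move: il jl; rewrite !mem_iota /= !add0n -zw => il jl.
  rewrite !ltnS in il jl.
  by move: (congr1 size tE); rewrite -zw !size_takel // => ->.
- apply: allpairs_uniq_dep => [|B _|]; first exact: enum_uniq.
    apply: allpairs_uniq; [exact: linext_uniq|exact: linext_uniq|].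
    by move=> [? ?] [? ?] _ _.
  move=> _ _ /allpairsPdep[B [q [_ ql ->]]] /allpairsPdep[C [r [_ rl ->]]] /= qr.
  move: ql rl; rewrite -qr => /allpairsP[[u v] /= [ul _ ->]].
  move=> /allpairsP[[u' v'] /= [ul' _ []]] uu _.
  suff -> : B = C by [].
  by apply/setP => x; rewrite -(linext_mem ul) -(linext_mem ul') uu.
move=> [u v]; apply/allpairsPdep/allpairsPdep.
  move=> [z [i [zl _ [-> ->]]]]; have [dB t1 t2] := linext_split i zl.
  eexists; exists (take i z, drop i z); split; last by [].
    by rewrite mem_enum; exact: dB.
  by apply/allpairsP; exists (take i z, drop i z).
move=> [B [q [Bd ql qE]]]; move: ql; rewrite -qE.
move=> /allpairsP[[u' v'] /= [ul vl [-> ->]]].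
rewrite mem_enum in Bd; exists (u' ++ v'), (size u'); split.
- exact: (linext_cat Bd).
- by rewrite (mem_iota 0 (size (u' ++ v')).+1) ltnS size_cat leq_addr.
by rewrite take_size_cat // drop_size_cat.
Qed.

End PositionSets.

(** * Convolution powers paired with shuffles, as sums over ordered partitions *)

Section OrderedDecompositions.
Set Implicit Arguments.
Unset Strict Implicit.
Variables (R : realType) (d k : nat) (tau : 'I_k -> word d).
Implicit Types (B D : {set Ptau tau}) (j : 'I_k) (x y : Ptau tau).
Implicit Types (s t q : tseries R d).

(** The pairing of [s] with the shuffle of the words read along [D], as [shuffle_sumE] shows;
    summing over sequences of positions allows it to be cut. *)
Definition shuffle_sum s D : R := \sum_(z <- linext D) s [seq letter x | x <- z].

Lemma shuffle_sum_tmul s t D :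
  shuffle_sum (tmul s t) D =
  \sum_(B | lower_part B D) shuffle_sum s B * shuffle_sum t (D :\: B)%SET.
Proof.
pose F u v := s [seq letter x | x <- u] * t [seq letter x | x <- v].
transitivity (\sum_(z <- linext D) \sum_(i < (size z).+1) F (take i z) (drop i z)).
  apply: eq_bigr => z _; rewrite /tmul size_map; apply: eq_bigr => i _.
  by rewrite /F map_take map_drop.
rewrite sum_linext_split; apply: eq_bigr => B _.
by rewrite big_distrlr.
Qed.

Lemma pairwise_filter_cat (T : eqType) (r : rel T) (p : pred T) (z : seq T) :
  pairwise r z -> {in z &, forall u v, r u v -> p v -> p u} ->
  z = seq.filter p z ++ seq.filter (predC p) z.
Proof.
elim: z => //= a z IH /andP[/allP ra rz] h.
have {}IH : z = seq.filter p z ++ seq.filter (predC p) z.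
  by apply: IH => // u v uz vz; apply: h; rewrite inE ?uz ?vz orbT.
case: ifP => pa /=; first by rewrite -IH.
have pz : all (predC p) z.
  apply/allP => v vz /=; apply: contraFN pa; apply: h (ra _ vz).
    by rewrite mem_head.
  by rewrite inE vz orbT.
have -> : seq.filter p z = [::] by apply/eqP; rewrite filter_eq_nil.
by rewrite (all_filterP pz).
Qed.

Lemma full_chain_pairwise j :
  pairwise (fun x x' => tagged x < tagged x')%N (full_chain tau j).
Proof.
rewrite /full_chain pairwise_map.
have := iota_ltn_sorted 0 (size (tau j)).
by rewrite -val_enum_ord (sorted_pairwise ltn_trans) pairwise_map.
Qed.

(** Positions increase along each chain and different chains are incomparable, so [B] is an initial
    piece of every chain of [D] exactly when it is downward closed in [D]. *)
Lemma lower_partE B D :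
  lower_part B D = (B \subset D) &&
    [forall x in D, forall y in B, pos_le x y ==> (x \in B)].
Proof.
rewrite /lower_part; case: (boolP (B \subset D)) => //= BD.
apply/forallP/forallP => [h x|h j].
  apply/implyP => xD; apply/forallP => y; apply/implyP => yB.
  apply/implyP => /andP[/eqP xy xley]; apply: contraLR xley => xB.
  have := full_chain_pairwise (tag x).
  move/(pairwise_filter (fun x => x \in D)); rewrite -/(chain D _).
  rewrite (eqP (h _)) pairwise_cat => /andP[/allrelP /(_ y x) yx _].
  by rewrite -ltnNge yx // mem_chain ?inE ?xB ?xD ?yB ?xy eqxx.
apply/eqP; rewrite [LHS](@pairwise_filter_cat _
  (fun x x' => tagged x < tagged x')%N (fun x => x \in B)).
- rewrite /chain -!filter_predI; congr (_ ++ _).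
  + apply: eq_filter => x /=; case: (boolP (x \in B)) => //=.
    by move/(fintype.subsetP BD).
  + by apply: eq_filter => x /=; rewrite !inE.
- exact/pairwise_filter/full_chain_pairwise.
move=> u v; rewrite !mem_chain => /andP[uD /eqP uj] /andP[vD /eqP vj] uv vB.
move/implyP: (h u) => /(_ uD)/forallP/(_ v)/implyP/(_ vB)/implyP; apply.
by apply/andP; split; [rewrite uj vj|exact: ltnW].
Qed.

Section Levels.
Variable n : nat.
Implicit Types f : {ffun Ptau tau -> 'I_n.+1}.

Definition monotone f : bool :=
  [forall x, forall y, pos_le x y ==> (f x <= f y)%N].

Definition fibre f (b : nat) : {set Ptau tau} :=
  [set x | nat_of_ord (f x) == b]%SET.

(* Maps with values in [0, m+1] correspond to pairs of a map with values in [0, m]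
   and a lower part of its top fibre: [cap] merges the two top levels, and [uncap]
   moves the complement of the lower part up to level [m+1]. *)
Definition cap m f : {ffun Ptau tau -> 'I_n.+1} :=
  [ffun x => inord (minn (f x) m)].

Definition uncap m (fB : {ffun Ptau tau -> 'I_n.+1} * {set Ptau tau}) :
    {ffun Ptau tau -> 'I_n.+1} :=
  [ffun x => if (nat_of_ord (fB.1 x) == m) && (x \notin fB.2) then inord m.+1
             else fB.1 x].

Lemma capE m f x : cap m f x = minn (f x) m :> nat.
Proof.
by rewrite ffunE inordK // (leq_ltn_trans (geq_minl _ _)).
Qed.

Lemma uncapE m f B x : (m < n)%N ->
  uncap m (f, B) x =
  (if (nat_of_ord (f x) == m) && (x \notin B) then m.+1 else f x) :> nat.
Proof. by move=> mn; rewrite ffunE /=; case: ifP => // _; rewrite inordK. Qed.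

Lemma monotoneP f :
  reflect (forall x y, pos_le x y -> (f x <= f y)%N) (monotone f).
Proof.
apply: (iffP forallP) => [h x y xy|h x].
  by move/forallP: (h x) => /(_ y)/implyP; apply.
by apply/forallP => y; apply/implyP; exact: h.
Qed.

Lemma cap_uncap m f B : (m < n)%N -> (forall x, (f x <= m)%N) ->
  B \subset fibre f m ->
  (cap m (uncap m (f, B)), fibre (uncap m (f, B)) m) = (f, B).
Proof.
move=> mn fm /fintype.subsetP Bf; congr pair.
  apply/ffunP => x; apply: val_inj; rewrite /= capE uncapE //.
  by case: ifP => [/andP[/eqP-> _]|_]; [apply/minn_idPr|apply/minn_idPl].
apply/setP => x; rewrite inE uncapE //; have := Bf x; rewrite inE.
case: (x \in B) => [/(_ isT)|_]; first by rewrite andbF.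
rewrite andbT; case: ifP => //; lia.
Qed.

(** The left side is the condition produced by reindexing along [cap] and [uncap]. Its last equation
    amounts to the bound m+1 on [f], and the lower part supplies the monotonicity between levels m
    and m+1 that [cap] forgets. *)
Lemma cap_monotone m f : (m < n)%N ->
  [&& monotone (cap m f), [forall x, (cap m f x <= m)%N] &
      lower_part (fibre f m) (fibre (cap m f) m)] &&
  (uncap m (cap m f, fibre f m) == f) =
  monotone f && [forall x, (f x <= m.+1)%N].
Proof.
move=> mn; apply/andP/andP => [[/and3P[/monotoneP cm _]]|].
  rewrite lower_partE => /andP[_ /forallP dn] /eqP cf.
  have fm x : (f x <= m.+1)%N.
    by rewrite -cf uncapE // capE; case: ifP => // _; lia.
  split; last exact/forallP.
  apply/monotoneP => x y xy; have := cm _ _ xy; rewrite !capE.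
  move/implyP: (dn x); rewrite inE capE => /= h.
  have {}h : (minn (f x) m == m) -> nat_of_ord (f y) == m -> nat_of_ord (f x) == m.
    move=> /h /forallP/(_ y)/implyP h2 ym.
    by move: h2; rewrite !inE => /(_ ym)/implyP; apply.
  move: h (fm x) (fm y); move: (nat_of_ord (f x)) (nat_of_ord (f y)) => a b h.
  move=> am bm /= ab; case: (leqP a m) => am'.
    by move: ab; rewrite (minn_idPl am') leq_min => /andP[].
  have bm' : (m <= b)%N by move: ab; rewrite (minn_idPr (ltnW am')) leq_min => /andP[].
  case: (ltnP m b) => [|bm'']; first exact: leq_trans.
  have bE : b = m by apply/eqP; rewrite eqn_leq bm''.
  by have := h; rewrite (minn_idPr (ltnW am')) bE eqxx => /(_ isT isT)/eqP ->.
move=> [/monotoneP fmono /forallP fm]; split; last first.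
  apply/eqP/ffunP => x; apply: val_inj; rewrite /= uncapE // capE inE.
  move: (fm x); move: (nat_of_ord (f x)) => a; case: ifP; lia.
apply/and3P; split.
- by apply/monotoneP => x y /fmono; rewrite !capE; lia.
- by apply/forallP => x; rewrite capE geq_minr.
rewrite lower_partE; apply/andP; split.
  by apply/fintype.subsetP => x; rewrite !inE capE => /eqP->; rewrite minnn.
apply/forallP => x; apply/implyP; rewrite inE capE => /eqP xm.
apply/forallP => y; apply/implyP; rewrite inE => /eqP ym.
by apply/implyP => /fmono; rewrite inE; lia.
Qed.

(** Induction on [m] with [t] general: one factor [q] moves into [t], and [shuffle_sum_tmul] splits
    the top fibre into a lower part, level m, and its complement, level m+1. The codomain keeps size
    n+1 throughout, so all stages live in one finite type. *)
Lemma shuffle_sum_iter q t m : (m <= n)%N ->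
  shuffle_sum (iter m (tmul q) t) [set: Ptau tau]%SET =
  \sum_(f | monotone f && [forall x, (f x <= m)%N])
     (\prod_(b < m) shuffle_sum q (fibre f b)) * shuffle_sum t (fibre f m).
Proof.
elim: m t => [|m IH] t mn.
  rewrite (big_pred1 [ffun=> ord0]) => [|f].
    rewrite big_ord0 mul1r /=; congr shuffle_sum.
    by apply/setP => x; rewrite !inE ffunE.
  apply/andP/eqP => [[_ /forallP f0]|->].
    by apply/ffunP => x; apply: val_inj; rewrite ffunE /=; have := f0 x; rewrite leqn0 => /eqP.
  by split; [apply/monotoneP => x y' _|apply/forallP => x]; rewrite !ffunE.
rewrite iterSr IH ?(ltnW mn) //.
under eq_bigr do rewrite shuffle_sum_tmul big_distrr.
rewrite pair_big_dep /=.
rewrite (reindex_onto (fun f => (cap m f, fibre f m)) (uncap m)) /=; last first.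
  move=> [f B] /= /andP[/andP[_ /forallP fm] /andP[Bf _]].
  exact: cap_uncap.
apply: eq_big => [f|f].
  by rewrite -cap_monotone // !andbA.
rewrite -!andbA [X in [&& _, _ & X]]andbA !andbA -[X in X && _]andbA.
rewrite -[X in X && _]andbA cap_monotone // => /andP[_ /forallP fm].
rewrite big_ord_recr /= !mulrA; congr (_ * _ * _).
  apply: eq_bigr => b _; congr shuffle_sum; apply/setP => x.
  by rewrite !inE capE; move: (nat_of_ord (f x)) (ltn_ord b) => a; lia.
congr shuffle_sum; apply/setP => x; rewrite !inE capE.
by move: (fm x); move: (nat_of_ord (f x)) => a; lia.
Qed.

End Levels.

Lemma tmul_tone q : tmul q (@tone R d) = q.
Proof.
apply/funext => w; rewrite /tmul big_ord_recr /= take_size drop_size.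
rewrite /tone eqxx mulr1 big1 ?add0r // => i _.
rewrite -size_eq0 size_drop subn_eq0 leqNgt ltn_ord /=.
by rewrite mulr0.
Qed.

Lemma tpow_iter q n : tpow q n = iter n (tmul q) (@tone R d).
Proof. by elim: n => //= n ->. Qed.

Lemma shuffle_sum_tpow q n :
  shuffle_sum (tpow q n.+1) [set: Ptau tau]%SET =
  \sum_(f : {ffun Ptau tau -> 'I_n.+1} | monotone f)
     \prod_(b < n.+1) shuffle_sum q (fibre f b).
Proof.
(* The last factor absorbs the unit, leaving n products applied to [q], hence n+1 levels all
   weighted by [q]. *)
rewrite tpow_iter iterSr tmul_tone (shuffle_sum_iter (n := n)) //.
apply: eq_big => [f|f _]; last by rewrite big_ord_recr.
by rewrite (_ : [forall x, _]) ?andbT //; apply/forallP => x; rewrite -ltnS.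
Qed.

Lemma shuffle_sum0 q : q [::] = 0 -> shuffle_sum q finset.set0 = 0.
Proof.
move=> q0; rewrite /shuffle_sum big1_seq // => z /andP[_ /linext_mem zE].
by case: z zE => [//|x z /(_ x)]; rewrite mem_head inE.
Qed.

Lemma kersetE n (f : {ffun Ptau tau -> 'I_n.+1}) :
  kerset f = [set fibre f (nat_of_ord b) | b in [set f x | x : Ptau tau]]%SET.
Proof.
apply/setP => C; apply/imsetP/imsetP => [[x _ ->]|[_ /imsetP[x _ ->] ->]].
  by exists (f x); [apply/imsetP; exists x|apply/setP => z; rewrite !inE].
by exists x => //; apply/setP => z; rewrite !inE.
Qed.

Lemma card_kerset n (f : {ffun Ptau tau -> 'I_n.+1}) :
  #|kerset f| = #|[set f x | x : Ptau tau]%SET|.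
Proof.
rewrite kersetE card_in_imset // => _ b /imsetP[x _ ->] _ /setP/(_ x).
by rewrite !inE eqxx => /esym/eqP/val_inj.
Qed.

Lemma ofactE n (a : {set {set Ptau tau}}) : #|a| = n.+1 ->
  ofact a = #|[set f : {ffun Ptau tau -> 'I_n.+1} |
               monotone f && (kerset f == a)]%SET|.
Proof. by rewrite /ofact => ->. Qed.

(** A map that misses a level has an empty fibre, where the sum vanishes. The remaining surjections
    are grouped by kernel: their weight depends on the kernel only, and [ofact a] of them have
    kernel [a]. *)
Lemma shuffle_sum_tpow_ofact q n : q [::] = 0 ->
  shuffle_sum (tpow q n.+1) [set: Ptau tau]%SET =
  \sum_(a : {set {set Ptau tau}} | #|a| == n.+1)
     (ofact a)%:R * \prod_(B in a) shuffle_sum q B.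
Proof.
move=> q0; rewrite shuffle_sum_tpow.
rewrite (bigID (fun f : {ffun Ptau tau -> 'I_n.+1} => #|kerset f| == n.+1)) /= [X in _ + X]big1 ?addr0.
  rewrite (partition_big (fun f : {ffun _ -> _} => kerset f)
             (fun a => #|a| == n.+1)) /=; last by move=> f /andP[].
  apply: eq_bigr => a /eqP an; rewrite (ofactE an) -sum1_card natr_sum mulr_suml.
  apply: eq_big => [f|f].
    rewrite inE -andbA; congr (_ && _).
    by case: (_ =P a) => [->|]; rewrite ?andbT ?andbF // an eqxx.
  case/andP => /andP[_ /eqP fn] /eqP <-; rewrite mul1r kersetE big_imset /=.
    have /eqP-> : [set f x | x : Ptau tau]%SET == finset.setT.
      by rewrite eqEcard finset.subsetT /= cardsT card_ord -card_kerset fn.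
    by apply: eq_bigl => b; rewrite inE.
  move=> _ b /imsetP[x _ ->] _ /setP/(_ x).
  by rewrite !inE eqxx => /esym/eqP/val_inj.
move=> f /andP[_ fn].
have [b bf] : exists b, b \notin [set f x | x : Ptau tau]%SET.
  apply/existsP; rewrite -negb_forall; apply: contra fn => /forallP h.
  rewrite card_kerset (_ : imset _ _ = finset.setT) ?cardsT ?card_ord //.
  by apply/setP => b; rewrite h inE.
rewrite (bigD1 b) //= (_ : fibre f b = finset.set0) ?shuffle_sum0 ?mul0r //.
apply/setP => x; rewrite !inE; apply: contraNF bf => /eqP/val_inj <-.
exact: imset_f.
Qed.

Lemma ofact_eq0 (a : {set {set Ptau tau}}) : a \notin Orp tau -> ofact a = 0%N.
Proof.
move=> aO; apply/eqP; rewrite cards_eq0; apply: contraR aO => /set0Pn[g].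
rewrite inE => /andP[/forallP gm /eqP ga]; rewrite inE; apply/asboolP.
exists (fun x => nat_of_ord (g x)); split.
  by move=> x y xy; move/forallP: (gm x) => /(_ y)/implyP; apply.
rewrite -{1}ga; apply/setP => C.
by apply/imsetP/imsetP => -[x _ ->]; exists x => //; apply/setP => z; rewrite !inE.
Qed.

Lemma Orp_card (a : {set {set Ptau tau}}) : (0 < #|Ptau tau|)%N ->
  a \in Orp tau -> (0 < #|a| < #|Ptau tau|.+1)%N.
Proof.
move=> /card_gt0P[x0 _]; rewrite inE => /asboolP[f [_ ->]]; rewrite ltnS.
apply/andP; split; last by rewrite leq_imset_card.
by apply/card_gt0P; eexists; apply/imsetP; exists x0.
Qed.

(** The coefficients [c] are free, to serve both the logarithm and the exponential. Stopping at the
    number of positions loses nothing, since no partition has more blocks. *)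
Lemma shuffle_sum_series q (c : nat -> R) :
  q [::] = 0 -> (0 < #|Ptau tau|)%N ->
  \sum_(1 <= n < #|Ptau tau|.+1)
     c n * shuffle_sum (tpow q n) [set: Ptau tau]%SET =
  \sum_(a in Orp tau) c #|a| * (ofact a)%:R * \prod_(B in a) shuffle_sum q B.
Proof.
move=> q0 P0; pose G (a : {set {set Ptau tau}}) := c #|a| * (ofact a)%:R * \prod_(B in a) shuffle_sum q B.
transitivity (\sum_(1 <= n < #|Ptau tau|.+1) \sum_(a in Orp tau | n == #|a|) G a).
  rewrite big_nat_cond [RHS]big_nat_cond; apply: eq_bigr => n; rewrite andbT.
  case: n => // n _; rewrite shuffle_sum_tpow_ofact // big_distrr /=.
  rewrite (bigID (fun a => a \in Orp tau)) /= [X in _ + X]big1 ?addr0.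
    apply: eq_big => [a|a]; first by rewrite andbC eq_sym.
    by move=> /andP[/eqP <- _]; rewrite mulrA.
  by move=> a /andP[_ /ofact_eq0->]; rewrite mul0r mulr0.
rewrite (exchange_big_dep (fun a => a \in Orp tau)) /=; last by move=> ? ? _ /andP[].
apply: eq_bigr => a aO; under eq_bigl do rewrite aO /=.
by rewrite big_nat1_eq Orp_card.
Qed.

End OrderedDecompositions.

(** * Substitution of a series into polynomials under convolution *)

Section ConvolutionPowers.
Set Implicit Arguments.
Unset Strict Implicit.
Variables (R : realType) (d : nat).
Implicit Types (s t r x y : tseries R d) (w : word d) (p q : {poly R}).

Lemma tmul_cons s t a w :
  tmul s t (a :: w) = s [::] * t (a :: w) + tmul (fun v => s (a :: v)) t w.
Proof. by rewrite /tmul big_ord_recl. Qed.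

Lemma tmul_nil s t : tmul s t [::] = s [::] * t [::].
Proof. by rewrite /tmul big_ord_recl big_ord0 addr0. Qed.

Lemma tmulDl s s' t w :
  tmul (fun v => s v + s' v) t w = tmul s t w + tmul s' t w.
Proof. by rewrite /tmul -big_split; apply: eq_bigr => i _; rewrite mulrDl. Qed.

Lemma tmulZl (c : R) s t w : tmul (fun v => c * s v) t w = c * tmul s t w.
Proof.
by rewrite /tmul big_distrr; apply: eq_bigr => i _; rewrite -mulrA.
Qed.

Lemma tmul1t t : tmul (@tone R d) t = t.
Proof.
apply/funext => w; rewrite /tmul big_ord_recl take0 drop0 /tone eqxx mul1r.
rewrite big1 ?addr0 // => i _; case: w i => [|a w] i; first by case: i.
by rewrite /= mul0r.
Qed.

Lemma tmulA s t r : tmul s (tmul t r) = tmul (tmul s t) r.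
Proof.
apply/funext => w; elim: w s t r => [|a w IH] s t r.
  by rewrite !tmul_nil mulrA.
rewrite [RHS]tmul_cons tmul_nil.
rewrite (_ : (fun v => _) = fun v => s [::] * t (a :: v) +
  tmul (fun v => s (a :: v)) t v); last by apply/funext => v; rewrite tmul_cons.
rewrite tmulDl tmulZl -IH tmul_cons tmul_cons.
by rewrite mulrDr mulrA addrA.
Qed.

Lemma tpow_small x n w : x [::] = 0 -> (size w < n)%N -> tpow x n w = 0.
Proof.
move=> x0; elim: n w => // n IH w wn /=; rewrite /tmul big1 // => -[[|i] iw] _ /=.
  by rewrite take0 x0 mul0r.
rewrite IH ?mulr0 // size_drop; move: iw wn => /=; lia.
Qed.

(** This is [p] evaluated at [x] with convolution as product. Stopping at the length of [w] is exact
    when [x [::] = 0], by [tpow_small]. *)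
Definition poly_tpow x p : tseries R d :=
  fun w => \sum_(i < (size w).+1) p`_i * tpow x i w.

Lemma poly_tpow_widen x p w n : x [::] = 0 -> (size w <= n)%N ->
  poly_tpow x p w = \sum_(i < n.+1) p`_i * tpow x i w.
Proof.
move=> x0 wn; rewrite /poly_tpow.
rewrite (big_ord_widen n.+1 (fun i => p`_i * tpow x i w)) // big_mkcond /=.
apply: eq_bigr => i _; case: ifPn => //; rewrite -leqNgt => wi.
by rewrite tpow_small ?mulr0.
Qed.

Lemma poly_tpowD x p q w :
  poly_tpow x (p + q) w = poly_tpow x p w + poly_tpow x q w.
Proof.
by rewrite -big_split; apply: eq_bigr => i _; rewrite coefD mulrDl.
Qed.

Lemma poly_tpowZ x (c : R) p w : poly_tpow x (c *: p) w = c * poly_tpow x p w.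
Proof. by rewrite big_distrr; apply: eq_bigr => i _; rewrite coefZ /= mulrA. Qed.

Lemma poly_tpow0 x w : poly_tpow x 0 w = 0.
Proof. by rewrite /poly_tpow big1 // => i _; rewrite coef0 mul0r. Qed.

Lemma poly_tpow1 x w : poly_tpow x 1 w = tone R w.
Proof.
rewrite /poly_tpow big_ord_recl coef1 mul1r big1 ?addr0 // => i _.
by rewrite coef1 mul0r.
Qed.

Lemma poly_tpow_sum x n (F : nat -> {poly R}) w :
  poly_tpow x (\sum_(i < n) F i) w = \sum_(i < n) poly_tpow x (F i) w.
Proof.
elim: n => [|n IH]; first by rewrite !big_ord0 poly_tpow0.
by rewrite !big_ord_recr poly_tpowD IH.
Qed.

Lemma poly_tpowMX x p : x [::] = 0 ->
  poly_tpow x (p * 'X) = tmul x (poly_tpow x p).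
Proof.
move=> x0; apply/funext => w; rewrite /poly_tpow big_ord_recl.
rewrite coefMX eqxx mul0r add0r.
transitivity (\sum_(i < (size w).+1) p`_i * tmul x (tpow x i) w).
  rewrite [RHS]big_ord_recr /= -/(tpow x (size w).+1) [X in _ = _ + _ * X]tpow_small //.
  rewrite mulr0 addr0; apply: eq_bigr => i _.
  by rewrite coefMX.
transitivity (\sum_(i < (size w).+1) \sum_(j < (size w).+1)
   x (take j w) * (p`_i * tpow x i (drop j w))).
  apply: eq_bigr => i _; rewrite /tmul big_distrr; apply: eq_bigr => j _ /=.
  by rewrite mulrCA.
rewrite exchange_big; apply: eq_bigr => j _ /=; rewrite -big_distrr /=; congr (_ * _).
by rewrite -(poly_tpow_widen _ x0) // size_drop leq_subr.
Qed.

(** Multiplicativity reduces identities between series in [x] to identities between polynomials; it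
    follows by induction on the Horner form of [p]. *)
Lemma poly_tpowM x p q : x [::] = 0 ->
  poly_tpow x (p * q) = tmul (poly_tpow x p) (poly_tpow x q).
Proof.
move=> x0; elim/poly_ind: p => [|p c IH]; apply/funext => w.
  rewrite mul0r poly_tpow0 /tmul big1 // => i _.
  by rewrite poly_tpow0 mul0r.
rewrite mulrDl -mulrA (mulrC 'X) mulrA mul_polyC poly_tpowD poly_tpowZ.
rewrite poly_tpowMX // IH.
have -> : poly_tpow x (p * 'X + c%:P) =
    fun v => tmul x (poly_tpow x p) v + c * tone R v; last first.
  by rewrite tmulDl tmulZl tmul1t tmulA.
apply/funext => v; rewrite poly_tpowD poly_tpowMX //.
by rewrite -[c%:P]mulr1 mul_polyC poly_tpowZ poly_tpow1.
Qed.

End ConvolutionPowers.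

(** * The exponential inverts the logarithm, through truncated polynomials *)

Section ExponentialLogarithm.
Set Implicit Arguments.
Unset Strict Implicit.
Variables (R : realType).
Implicit Types (p q : {poly R}).

(* The constant coefficient is [(-1)^0 / 0 = 0]. *)
Definition log_poly (N : nat) : {poly R} :=
  \poly_(i < N.+1) ((-1) ^+ i.-1 / i%:R).

Definition exp_poly (N : nat) p : {poly R} :=
  \sum_(n < N.+1) (n`!)%:R^-1 *: p ^+ n.

Lemma exprNX n : (- 'X) ^+ n = (-1) ^+ n *: 'X^n :> {poly R}.
Proof. by rewrite -scaleN1r exprZn. Qed.

(** The derivative is the geometric sum in -X, which multiplication by 1 + X telescopes. *)
Lemma deriv_log_poly N :
  (1 + 'X) * (log_poly N)^`() = 1 - (- 'X) ^+ N :> {poly R}.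
Proof.
have -> : (log_poly N)^`() = \sum_(i < N) (- 'X) ^+ i.
  apply/polyP => i; rewrite coef_deriv coef_poly ltnS coef_sum.
  under eq_bigr do rewrite exprNX coefZ coefXn.
  have [iN|iN] := ltnP i N; last first.
    rewrite mul0rn big1 // => j _; case: eqP => [ij|]; last by rewrite mulr0.
    by move: (ltn_ord j); rewrite -ij ltnNge iN.
  rewrite (bigD1 (Ordinal iN)) //= eqxx mulr1 big1 ?addr0.
    by rewrite -[LHS]mulr_natr divfK // pnatr_eq0.
  move=> j ji; have /negbTE-> : i != j by rewrite eq_sym.
  by rewrite mulr0.
rewrite -[1 + 'X]opprK opprD [- 1 - _]addrC mulNr -subrX1.
by rewrite opprB.
Qed.

Lemma coef_exp_log_small N p i : p`_0 = 0 -> (i < N)%N -> (p ^+ N)`_i = 0.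
Proof.
move=> p0; elim: N p p0 i => // N IH p p0 i iN.
rewrite exprS coefM big1 // => -[[|j] ji] _ /=; first by rewrite p0 mul0r.
rewrite IH ?mulr0 //; move: ji iN; lia.
Qed.

(* [L = log_poly N] satisfies [(1 + X) L' = 1 - (-X)^N], so [E = exp_poly N L]
   satisfies [(1 + X) E' = E] modulo [X^N]; this recurrence determines the
   coefficients of [E] up to degree [N]. *)
Lemma exp_log_poly N i : (i <= N)%N ->
  (exp_poly N (log_poly N))`_i = (1 + 'X : {poly R})`_i.
Proof.
set L := log_poly N; set E := exp_poly N L.
have L0 : L`_0 = 0 by rewrite coef_poly /= invr0 mulr0.
(* [S] is [E] without its last term, as it arises in E' = L' S. The two agree below degree N because
   L^N has no coefficient there. *)
pose S := \sum_(n < N) (n`!)%:R^-1 *: L ^+ n.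
have ES j : (j < N)%N -> E`_j = S`_j.
  move=> jN; rewrite /E /exp_poly big_ord_recr coefD coefZ coef_exp_log_small //.
  by rewrite mulr0 addr0.
have E' : E^`() = L^`() * S.
  rewrite /E /exp_poly big_ord_recl expr0 derivD derivZ -polyC1 derivC scaler0 add0r.
  rewrite raddf_sum /S big_distrr; apply: eq_bigr => n _ /=.
  rewrite derivZ deriv_exp /bump add1n /= -scalerMnr scalerMnl -scalerAr.
  congr (_ *: _); rewrite -[LHS]mulr_natr factS natrM invfM mulrAC.
  by rewrite mulVf ?mul1r ?pnatr_eq0.
(* Coefficients of X^j are compared in (1 + X) E' = (1 - (-X)^N) S. The resulting factor 1 - j
   vanishes at j = 1, so E_2 = 0 and the later coefficients up to N vanish in turn. *)
have rec j : (j < N)%N -> E`_j.+1 *+ j.+1 = E`_j - E`_j *+ j.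
  move=> jN; have := congr1 (fun q : {poly R} => q`_j) (congr1 (fun q => (1 + 'X) * q) E').
  rewrite mulrA deriv_log_poly mulrBl mul1r coefB exprNX -scalerAl.
  rewrite coefZ coefXnM jN mulr0 subr0 -ES //.
  rewrite mulrDl mul1r coefD coefXM !coef_deriv.
  case: j jN => [|j] jN /=; first by rewrite addr0 mulr0n subr0.
  by move=> /esym h; apply/esym/eqP; rewrite subr_eq; apply/eqP.
have E0 : E`_0 = 1.
  rewrite /E /exp_poly big_ord_recl expr0 coefD coefZ coef1 fact0 invr1 mulr1.
  rewrite coef_sum big1 ?addr0 // => n _.
  by rewrite coefZ coef_exp_log_small ?mulr0.
have Rn (j : nat) (a : R) : a *+ j.+1 = 0 -> a = 0.
  by move/eqP; rewrite mulrn_eq0 => /eqP.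
elim: i => [|[|[|i]] IH] iN.
- by rewrite E0 coefD coef1 coefX addr0.
- by have := rec _ iN; rewrite E0 mulr1n mulr0n subr0 => ->; rewrite coefD coef1 coefX add0r.
- have := rec _ iN; rewrite IH ?(ltnW iN) // mulr1n subrr => /Rn ->.
  by rewrite coefD coef1 coefX add0r.
have := rec _ iN; rewrite IH ?(ltnW iN) //.
by rewrite !coefD !coef1 !coefX !addr0 mul0rn subr0 => /Rn.
Qed.

Variable d : nat.
Implicit Types (y : tseries R d) (w : word d).

Lemma tlog_poly y N w : y [::] = 1 -> (size w <= N)%N ->
  tlog y w = poly_tpow (fun v => y v - tone R v) (log_poly N) w.
Proof.
move=> y1 wN; rewrite /tlog /poly_tpow -(big_mkord xpredT (fun i => (log_poly N)`_i *
  tpow (fun v => y v - tone R v) i w)) big_ltn // coef_poly /= invr0 mulr0 mul0r.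
rewrite add0r; apply: eq_big_nat => i /andP[_ iw].
by rewrite coef_poly (leq_trans iw).
Qed.

Lemma tlog_nil y : tlog y [::] = 0.
Proof. by rewrite /tlog big_geq. Qed.

(** On words of length at most [N], [log_poly N] gives the logarithm exactly, and convolution only
    looks at subwords; so powers of the logarithm are powers of this polynomial substituted at y -
    1. *)
Lemma tpow_tlog y N n w : y [::] = 1 -> (size w <= N)%N ->
  tpow (tlog y) n w = poly_tpow (fun v => y v - tone R v) (log_poly N ^+ n) w.
Proof.
move=> y1; have x0 : y [::] - tone R [::] = 0 by rewrite y1 /tone /= subrr.
elim: n w => [|n IH] w wN; first by rewrite poly_tpow1.
rewrite exprS poly_tpowM //= /tmul; apply: eq_bigr => i _.
rewrite IH ?size_drop ?(leq_trans (leq_subr _ _)) // (tlog_poly (N := N)) //.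
by rewrite size_takel ?leq_ord // (leq_trans (leq_ord i)).
Qed.

Lemma texp_tlog y N w : y [::] = 1 -> (size w <= N)%N ->
  y w = \sum_(n < N.+1) (n`!)%:R^-1 * tpow (tlog y) n w.
Proof.
move=> y1 wN; pose x v := y v - tone R v.
have x0 : x [::] = 0 by rewrite /x y1 /tone /= subrr.
transitivity (poly_tpow x (exp_poly N (log_poly N)) w).
  transitivity (poly_tpow x (1 + 'X) w).
    rewrite poly_tpowD poly_tpow1 -['X]mul1r poly_tpowMX //.
    rewrite (_ : poly_tpow x 1 = @tone R d); last by apply/funext => v; rewrite poly_tpow1.
    by rewrite tmul_tone /x addrC subrK.
  apply: eq_bigr => i _; rewrite exp_log_poly //.
  by apply: leq_trans wN; rewrite -ltnS.
rewrite (poly_tpow_sum x N.+1 (fun n => (n`!)%:R^-1 *: log_poly N ^+ n)).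
by apply: eq_bigr => n _; rewrite poly_tpowZ (tpow_tlog _ y1 wN).
Qed.

End ExponentialLogarithm.

(** * Numberings of the blocks of an ordered partition *)

Section OrderedPartitionCounts.
Set Implicit Arguments.
Unset Strict Implicit.
Variables (d k : nat) (tau : 'I_k -> word d).
Implicit Types (x y : Ptau tau) (a : {set {set Ptau tau}}).

Lemma kerset_eq (U U' : eqType) (f : Ptau tau -> U) (g : Ptau tau -> U') x y :
  kerset f = kerset g -> (f x == f y) = (g x == g y).
Proof.
move=> fg; have : [set z | f z == f y]%SET \in kerset g.
  by rewrite -fg; apply/imsetP; exists y.
case/imsetP => u _ /setP E; have := E x; have := E y; rewrite !inE eqxx.
by move=> /esym/eqP-> ->.
Qed.

(* A block is sent to the number of blocks lying below it. *)
Lemma ofact_gt0 a : a \in Orp tau -> (0 < ofact a)%N.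
Proof.
rewrite inE => /asboolP[f [fmono ->{a}]].
pose block x := [set z | f z == f x]%SET.
pose below x := [set block y | y in [set y | (f y < f x)%N]]%SET.
have blockx x : block x \in kerset f by apply/imsetP; exists x.
have belowP x y : (block y \in below x) = (f y < f x)%N.
  apply/imsetP/idP => [[z]|yx]; last by exists y; rewrite // inE.
  by rewrite inE => zx /setP/(_ y); rewrite !inE eqxx => /esym/eqP->.
have below_sub x : below x \subset kerset f.
  by apply/fintype.subsetP => _ /imsetP[z _ ->].
have below_lt x : (#|below x| < #|kerset f|)%N.
  apply: proper_card; apply/properP; split=> //.
  by exists (block x); rewrite ?belowP ?ltnn.
have le_below x y : (f x <= f y)%N -> below x \subset below y.
  move=> xy; apply/fintype.subsetP => _ /imsetP[z zx ->]; rewrite belowP.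
  by move: zx; rewrite inE => /leq_trans; apply.
have lt_below x y : (f x < f y)%N -> (#|below x| < #|below y|)%N.
  move=> xy; apply/proper_card/properP; split; first exact/le_below/ltnW.
  by exists (block x); rewrite belowP ?ltnn.
have card_below z x : (#|below z| == #|below x|) = (f z == f x).
  case: (ltngtP (f z) (f x)) => [/lt_below/ltn_eqF//|/lt_below/gtn_eqF//|E].
  by rewrite eqn_leq !subset_leq_card // le_below // E.
pose g : {ffun Ptau tau -> 'I_#|kerset f|} := [ffun x => Ordinal (below_lt x)].
apply/card_gt0P; exists g; rewrite inE; apply/andP; split.
  apply/forallP => x; apply/forallP => y; apply/implyP => /fmono xy.
  by rewrite !ffunE /= subset_leq_card // le_below.
apply/eqP/setP => C; apply/imsetP/imsetP => -[x _ ->]; exists x => //;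
  apply/setP => z; rewrite !inE !ffunE -val_eqE /=.
- by rewrite card_below.
- by rewrite card_below.
Qed.

(** Induction on the level of [x] under [f]: surjectivity gives [y] one level lower, totality puts
    [y] below [x], and the common kernel forces [g y < g x]. *)
Lemma monotone_surj_le n (f g : {ffun Ptau tau -> 'I_n.+1}) :
  (forall x y, pos_le x y || pos_le y x) ->
  monotone f -> monotone g -> kerset f = kerset g -> #|kerset f| = n.+1 ->
  forall x, (f x <= g x)%N.
Proof.
move=> tot /monotoneP fmono /monotoneP gmono fg fn.
have surj b : exists x, f x = b.
  have : b \in [set f x | x : Ptau tau]%SET.
    rewrite (_ : imset _ _ = finset.setT) ?inE //.
    by apply/eqP; rewrite eqEcard finset.subsetT /= cardsT card_ord -card_kerset fn.
  by case/imsetP => x _ ->; exists x.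
have {}surj c : (c <= n)%N -> exists x, f x = c :> nat.
  by move=> cn; have [x fx] := surj (inord c); exists x; rewrite fx inordK.
move=> x; move: {2}(nat_of_ord (f x)) (erefl (nat_of_ord (f x))) => c.
elim: c x => [|c IH] x fx; rewrite fx //.
have [|y fy] := surj c; first by rewrite -ltnS -fx ltnW.
have := IH y fy; rewrite fy => cy; apply: (leq_ltn_trans cy).
have xy : ~~ pos_le x y by apply/negP => /fmono; rewrite fx fy ltnn.
have yx : pos_le y x by have := tot x y; rewrite (negbTE xy).
rewrite ltn_neqAle gmono // andbT (inj_eq val_inj) -(kerset_eq _ _ fg).
by rewrite -val_eqE /= fx fy neq_ltn ltnSn.
Qed.

(** Two numberings of the blocks of a chain dominate each other by [monotone_surj_le], hence
    agree. *)
Lemma ofact_total a :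
  (forall x y, pos_le x y || pos_le y x) -> (0 < #|Ptau tau|)%N ->
  a \in Orp tau -> ofact a = 1%N.
Proof.
move=> tot P0 aO; apply/eqP; rewrite eqn_leq ofact_gt0 // andbT.
have := Orp_card P0 aO; case E : #|a| => [|n] // _.
rewrite (ofactE E); apply/card_le1_eqP => f g; rewrite !inE.
move=> /andP[fmono /eqP fa] /andP[gmono /eqP ga].
apply/ffunP => x; apply/val_inj/eqP; rewrite /= eqn_leq.
by rewrite !(@monotone_surj_le n) ?fa ?ga.
Qed.

Lemma card_Ptau : #|Ptau tau| = (\sum_(j < k) size (tau j))%N.
Proof. by rewrite card_tagged sumnE big_map big_enum; apply: eq_bigr => j _; rewrite card_ord. Qed.

Lemma card_Ptau_gt0 j : tau j != [::] -> (0 < #|Ptau tau|)%N.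
Proof.
move=> tj; have s0 : (0 < size (tau j))%N by rewrite lt0n size_eq0.
by apply/card_gt0P; exists (Tagged (fun j => 'I_(size (tau j))) (Ordinal s0)).
Qed.

Lemma Orp_neq0 a B : a \in Orp tau -> B \in a -> B != finset.set0.
Proof.
rewrite inE => /asboolP[f [_ ->]] /imsetP[x _ ->].
by apply/set0Pn; exists x; rewrite inE.
Qed.

End OrderedPartitionCounts.

(** * The logarithm of a series paired with a shuffle *)

Section CompensatedMoments.
Set Implicit Arguments.
Unset Strict Implicit.
Variables (R : realType) (d k : nat) (tau : 'I_k -> word d).
Implicit Types (y : tseries R d) (B : {set Ptau tau}).

Lemma shuffle_sumE y B :
  shuffle_sum y B = \sum_(w <- shuffle_all [seq blockword B j | j <- enum 'I_k]) y w.
Proof. by rewrite linext_letters big_map. Qed.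

Lemma shuffle_sum_setT y :
  shuffle_sum y [set: Ptau tau]%SET =
  \sum_(w <- shuffle_all [seq tau j | j <- enum 'I_k]) y w.
Proof.
rewrite shuffle_sumE; congr (\sum_(w <- shuffle_all _) y w).
by apply: eq_map => j; rewrite blockword_setT.
Qed.

(** [y] and y - 1 differ only at the empty word, which no linear extension of a nonempty block
    spells. This restores [y] on the blocks once the powers of y - 1 are expanded. *)
Lemma shuffle_sum_reduced y B : B != finset.set0 ->
  shuffle_sum (fun v => y v - tone R v) B = shuffle_sum y B.
Proof.
move=> B0; apply: eq_big_seq => z zB; rewrite /tone -size_eq0 size_map (linext_size zB).
by rewrite cards_eq0 (negbTE B0) subr0.
Qed.

Lemma shuffle_tlog y : y [::] = 1 -> (0 < #|Ptau tau|)%N ->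
  \sum_(w <- shuffle_all [seq tau j | j <- enum 'I_k]) tlog y w =
  \sum_(a in Orp tau) (-1) ^+ (#|a|.-1) * ((ofact a)%:R / (#|a|)%:R) *
     \prod_(B in a) shuffle_sum y B.
Proof.
move=> y1 P0; rewrite -shuffle_sum_setT.
pose x v := y v - tone R v; have x0 : x [::] = 0 by rewrite /x y1 /tone /= subrr.
(* All words of the shuffle have length [#|Ptau tau|], so [tlog] stops at the same power for each
   and the sums exchange. *)
transitivity (\sum_(1 <= n < #|Ptau tau|.+1)
   ((-1) ^+ n.-1 / n%:R) * shuffle_sum (tpow x n) [set: Ptau tau]%SET).
  rewrite /shuffle_sum; under [RHS]eq_bigr do rewrite big_distrr /=.
  rewrite exchange_big /=; apply: eq_big_seq => z zT.
  by rewrite /tlog size_map (linext_size zT) cardsT.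
rewrite (shuffle_sum_series (fun n => (-1) ^+ n.-1 / n%:R)) //.
apply: eq_bigr => a aO; rewrite -!mulrA; congr (_ * _).
rewrite mulrCA; congr (_ * (_ * _)).
by apply: eq_bigr => B Ba; rewrite shuffle_sum_reduced // (Orp_neq0 aO).
Qed.

End CompensatedMoments.

(** * The exponential expansion at a single word *)

Section MomentBijection.
Variables (R : realType) (d : nat).

Lemma shuffle_sum_ord1 (tau : word d) (y : tseries R d)
    (B : {set Ptau (fun _ : 'I_1 => tau)}) :
  shuffle_sum y B = y (blockword B ord0).
Proof. by rewrite shuffle_sumE enum_ordSl (size0nil (size_enum_ord 0)) /= shuffle_nilr big_seq1. Qed.

Lemma texp_ordered_partitions (y : tseries R d) (tau : word d) :
  y [::] = 1 -> tau != [::] ->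
  y tau = \sum_(a in Orp (fun _ : 'I_1 => tau))
    ((#|a|) `!)%:R^-1 * \prod_(B in a) tlog y (blockword B ord0).
Proof.
move=> y1 t0; pose T := fun _ : 'I_1 => tau.
have P0 : (0 < #|Ptau T|)%N by apply: (@card_Ptau_gt0 _ _ T ord0).
have PE : #|Ptau T| = size tau by rewrite card_Ptau big_ord1.
have tot (x x' : Ptau T) : pos_le x x' || pos_le x' x.
  case: x x' => [i q] [i' q']; rewrite /pos_le /= !(ord1 i) !(ord1 i') eqxx /=.
  exact: leq_total.
rewrite (texp_tlog (N := #|Ptau T|)) ?PE //.
rewrite -(big_mkord xpredT (fun n => (n`!)%:R^-1 * tpow (tlog y) n tau)) big_ltn //.
(* The zeroth power is the unit, which vanishes at the nonempty [tau], so the sum starts at n =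
   1. *)
rewrite [tpow _ 0 _]/(tone R tau) /tone (negbTE t0) mulr0 add0r.
transitivity (\sum_(1 <= n < #|Ptau T|.+1)
   (n`!)%:R^-1 * shuffle_sum (tpow (tlog y) n) [set: Ptau T]%SET).
  by rewrite PE; apply: eq_bigr => n _; rewrite shuffle_sum_ord1 blockword_setT.
rewrite (shuffle_sum_series (fun n => (n`!)%:R^-1)) ?tlog_nil //.
apply: eq_bigr => a aO; rewrite ofact_total // mulr1; congr (_ * _).
by apply: eq_bigr => B _; rewrite shuffle_sum_ord1.
Qed.

End MomentBijection.

(** * Pairings with the shuffle of two words *)

Section PairShuffles.
Set Implicit Arguments.
Unset Strict Implicit.
Variables (R : realType) (d : nat).
Implicit Types (s t y : tseries R d) (u v w : word d).
Local Arguments shuffle : simpl never.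

Definition pair_sum s u v : R := \sum_(w <- shuffle u v) s w.

Lemma pair_sum_nill s v : pair_sum s [::] v = s v.
Proof. by rewrite /pair_sum shuffle_nill big_seq1. Qed.

Lemma pair_sum_nilr s u : pair_sum s u [::] = s u.
Proof. by rewrite /pair_sum shuffle_nilr big_seq1. Qed.

Lemma pair_sum_cons s a u b v :
  pair_sum s (a :: u) (b :: v) =
  pair_sum (fun w => s (a :: w)) u (b :: v) + pair_sum (fun w => s (b :: w)) (a :: u) v.
Proof. by rewrite /pair_sum shuffle_cons big_cat !big_map. Qed.

Lemma pair_sumD s t u v : pair_sum (fun w => s w + t w) u v = pair_sum s u v + pair_sum t u v.
Proof. exact: big_split. Qed.

Lemma pair_sumZ (c : R) s u v : pair_sum (fun w => c * s w) u v = c * pair_sum s u v.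
Proof. by rewrite /pair_sum big_distrr. Qed.

(** Cutting an interleaving of [u] and [v] amounts to cutting both words and interleaving the
    prefixes and the suffixes separately: deconcatenation is a morphism for the shuffle product. *)
Lemma pair_sum_tmul s t u v :
  pair_sum (tmul s t) u v =
  \sum_(i < (size u).+1) \sum_(j < (size v).+1)
     pair_sum s (take i u) (take j v) * pair_sum t (drop i u) (drop j v).
Proof.
have tmulS s' a : (fun w => tmul s' t (a :: w)) =
    fun w => s' [::] * t (a :: w) + tmul (fun w => s' (a :: w)) t w.
  by apply/funext => w; rewrite tmul_cons.
elim: u v s => [|a u IHu] v s.
  rewrite pair_sum_nill [RHS]big_ord1 /tmul; apply: eq_bigr => j _ /=.
  by rewrite !pair_sum_nill.
elim: v s => [|b v IHv] s.
  by rewrite pair_sum_nilr /tmul; apply: eq_bigr => i _; rewrite [RHS]big_ord1 /= !pair_sum_nilr.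
rewrite pair_sum_cons !tmulS !pair_sumD !pair_sumZ IHu IHv addrACA -mulrDr -pair_sum_cons.
rewrite [RHS]big_ord_recl [in RHS]big_ord_recl !take0 !drop0 pair_sum_nill -!addrA.
congr (_ + _).
under [X in _ = _ + X]eq_bigr do rewrite big_ord_recl.
under [X in X + _ = _]eq_bigr do rewrite big_ord_recl.
rewrite [X in _ + X = _]big_ord_recl !big_split /= addrA addrC.
(* Past the term with both prefixes empty, three groups remain: empty prefix of [u], empty prefix of
   [v], both nonempty. In the last, [pair_sum_cons] recombines the two possible heads. *)
rewrite [LHS](AC (1*(2*1))%AC (4*(2*(3*1)))%AC) /=; congr (_ + (_ + _)).
- by apply: eq_bigr => j _; rewrite !pair_sum_nill.
- by apply: eq_bigr => i _; rewrite !pair_sum_nilr.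
rewrite -big_split /=; apply: eq_bigr => i _.
by rewrite -big_split /=; apply: eq_bigr => j _; rewrite pair_sum_cons mulrDl.
Qed.

Lemma size_shuffle u v w : w \in shuffle u v -> size w = (size u + size v)%N.
Proof.
elim: u v w => [|a u IHu] v w; first by rewrite shuffle_nill mem_seq1 => /eqP->.
elim: v w => [|b v IHv] w.
  by rewrite shuffle_nilr mem_seq1 addn0 => /eqP->.
rewrite shuffle_cons mem_cat => /orP[] /mapP[z zs ->] /=.
  by rewrite (IHu _ _ zs).
by rewrite (IHv _ zs) addnS.
Qed.

(** * The binomial formula for convolution powers on pairs of words *)

Section Binomial.
Variables (I J : {set 'I_d}) (kap : tseries R d) (N : nat).
Hypothesis kap0 : kap [::] = 0.
Hypothesis kap_mixed0 : forall u v, in_star I u -> in_star J v ->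
  (size u + size v < N)%N -> pair_sum kap u v = 0.

(** The obstruction to [kap] being primitive at the pair; an empty word causes none, hence the value
    0 there. *)
Definition mixed u v : R := if (u != [::]) && (v != [::]) then pair_sum kap u v else 0.

Lemma in_star0_take (K : {set 'I_d}) u i : in_star0 K u -> in_star0 K (take i u).
Proof. by move=> /allP h; apply/allP => x /mem_take; apply: h. Qed.

Lemma in_star0_drop (K : {set 'I_d}) u i : in_star0 K u -> in_star0 K (drop i u).
Proof. by move=> /allP h; apply/allP => x /mem_drop; apply: h. Qed.

Lemma mixed_eq0 u v : in_star0 I u -> in_star0 J v ->
  (size u + size v < N)%N -> mixed u v = 0.
Proof.
move=> uI vJ uvN; rewrite /mixed; case: ifP => // /andP[u0 v0].
by apply: kap_mixed0 => //; apply/andP.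
Qed.

(** In the double sum over cuts, two empty prefixes contribute nothing by [kap0]. Two nonempty
    prefixes contribute nothing by [kap_mixed0] unless they are all of [u] and [v], which gives the
    mixed term. One empty prefix gives the two single sums. *)
Lemma pair_sum_tmul_kap t u v : in_star0 I u -> in_star0 J v ->
  (size u + size v <= N)%N ->
  pair_sum (tmul kap t) u v =
  \sum_(i < (size u).+1) kap (take i u) * pair_sum t (drop i u) v +
  \sum_(j < (size v).+1) kap (take j v) * pair_sum t u (drop j v) +
  mixed u v * t [::].
Proof.
move=> uI vJ uvN; rewrite pair_sum_tmul big_ord_recl !take0 drop0.
rewrite [in RHS]big_ord_recl take0 kap0 mul0r add0r.
under eq_bigr do rewrite pair_sum_nill.
rewrite [LHS]addrC -[RHS]addrA [X in _ = _ + X]addrC [RHS]addrA; congr (_ + _).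
under eq_bigr do rewrite big_ord_recl take0 drop0 pair_sum_nilr.
rewrite big_split /=; congr (_ + _).
have small i j : (i <= size u)%N -> (j <= size v)%N ->
    (i + j < size u + size v)%N -> (0 < i)%N -> (0 < j)%N ->
    pair_sum kap (take i u) (take j v) = 0.
  move=> iu jv ij i0 j0; apply: kap_mixed0.
  - apply/andP; split; last exact: in_star0_take.
    by rewrite -size_eq0 size_takel // -lt0n.
  - apply/andP; split; last exact: in_star0_take.
    by rewrite -size_eq0 size_takel // -lt0n.
  by rewrite !size_takel // (leq_trans ij).
rewrite /mixed; case: u v uI vJ uvN small => [|a u] [|b v] uI vJ uvN small.
- by rewrite big_ord0 mul0r.
- by rewrite big_ord0 mul0r.
- by rewrite mul0r big1 // => i _; rewrite big_ord0.
rewrite [size (a :: u)]/= [size (b :: v)]/= big_ord_recr big_ord_recr /=.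
rewrite !take_size !drop_size pair_sum_nilr big1 ?add0r => [|i _].
  rewrite big1 ?add0r // => j _.
  have := small (size u).+1 j.+1; rewrite /= take_size => ->.
  - by rewrite mul0r.
  - by [].
  - by rewrite ltnW // ltnS.
  - by rewrite ltn_add2l ltnS.
  - by [].
  by [].
rewrite big1 // => j _.
have := small i.+1 j.+1; rewrite /= => ->.
- by rewrite mul0r.
- by rewrite ltnW // ltnS.
- exact: ltn_ord j.
- by move: (ltn_ord i) (ltn_ord j); rewrite /= ltnS; lia.
- by [].
by [].
Qed.

(* When [kap u' v'] vanishes on all strictly shorter mixed pairs, [kap] acts on pairs
   as a sum of two commuting elements, apart from its value at [(u, v)] itself,
   which is only seen by the first power. *)
Lemma pair_sum_tpow n u v : in_star0 I u -> in_star0 J v ->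
  (size u + size v <= N)%N ->
  pair_sum (tpow kap n) u v =
  \sum_(m < n.+1) 'C(n, m)%:R * (tpow kap m u * tpow kap (n - m) v) +
  (n == 1%N)%:R * mixed u v.
Proof.
elim: n u v => [|n IH] u v uI vJ uvN.
  rewrite big_ord1 mul0r addr0 bin0 mul1r /= /pair_sum /tone.
  case: u v {uI vJ uvN} => [|a u] v; first by rewrite shuffle_nill big_seq1 mul1r.
  rewrite mul0r big1_seq // => w /andP[_ /size_shuffle]; by case: w.
rewrite /= pair_sum_tmul_kap //.
(* Only the zeroth power is nonzero at the empty word, so [mixed u v] enters at exponent 1 alone. *)
have tn0 : tpow kap n [::] = (n.+1 == 1%N)%:R.
  by case: n {IH} => [|n] //; rewrite tpow_small.
rewrite tn0 [mixed u v * _]mulrC; congr (_ + _).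
have -> : \sum_(i < (size u).+1) kap (take i u) * pair_sum (tpow kap n) (drop i u) v =
    \sum_(m < n.+1) 'C(n, m)%:R * (tpow kap m.+1 u * tpow kap (n - m) v).
  transitivity (\sum_(i < (size u).+1) \sum_(m < n.+1)
      'C(n, m)%:R * (kap (take i u) * tpow kap m (drop i u) * tpow kap (n - m) v)).
    apply: eq_bigr => -[[|i] iu] _ /=.
      by rewrite take0 kap0 mul0r big1 // => m _; rewrite !mul0r mulr0.
    (* A nonempty cut makes the pair strictly shorter, so the mixed term of the induction hypothesis
       vanishes. *)
    have lt : (size (drop i.+1 u) + size v < size u + size v)%N.
      by rewrite size_drop ltn_add2r; move: iu; rewrite ltnS; lia.
    rewrite IH ?in_star0_drop ?(leq_trans (ltnW lt)) //.
    rewrite mixed_eq0 ?in_star0_drop ?(leq_trans lt) // mulr0 addr0.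
    by rewrite big_distrr /=; apply: eq_bigr => m _; ring.
  rewrite exchange_big /=; apply: eq_bigr => m _.
  by rewrite -big_distrr /= -big_distrl.
have -> : \sum_(j < (size v).+1) kap (take j v) * pair_sum (tpow kap n) u (drop j v) =
    \sum_(m < n.+1) 'C(n, m)%:R * (tpow kap m u * tpow kap (n - m).+1 v).
  transitivity (\sum_(j < (size v).+1) \sum_(m < n.+1)
      'C(n, m)%:R * (tpow kap m u * (kap (take j v) * tpow kap (n - m) (drop j v)))).
    apply: eq_bigr => -[[|j] jv] _ /=.
      by rewrite take0 kap0 mul0r big1 // => m _; rewrite !mul0r !mulr0.
    have lt : (size u + size (drop j.+1 v) < size u + size v)%N.
      by rewrite size_drop ltn_add2l; move: jv; rewrite ltnS; lia.
    rewrite IH ?in_star0_drop ?(leq_trans (ltnW lt)) //.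
    rewrite mixed_eq0 ?in_star0_drop ?(leq_trans lt) // mulr0 addr0.
    by rewrite big_distrr /=; apply: eq_bigr => m _; ring.
  rewrite exchange_big /=; apply: eq_bigr => m _.
  by rewrite -big_distrr /= -big_distrr.
(* Pascal's rule splits the right side into the two sums just computed. *)
rewrite [RHS]big_ord_recl bin0 subn0.
under [X in _ = _ + X]eq_bigr do
  rewrite lift0 binS natrD mulrDl subSS.
rewrite big_split /=.
rewrite addrA [RHS]addrC; congr (_ + _).
rewrite [LHS]big_ord_recl bin0 subn0; congr (_ + _).
rewrite [RHS]big_ord_recr /= bin_small // mul0r addr0.
by apply: eq_bigr => m _; rewrite -(subnSK (ltn_ord m)).
Qed.

End Binomial.

(** * Factorisation of a series on pairs and its mixed logarithm *)

Section Factorisation.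
Variables (I J : {set 'I_d}) (y : tseries R d).
Hypothesis y1 : y [::] = 1.

Lemma pair_sum_texp u v : in_star0 I u -> in_star0 J v ->
  (forall u' v', in_star I u' -> in_star J v' ->
    (size u' + size v' < size u + size v)%N -> pair_sum (tlog y) u' v' = 0) ->
  pair_sum y u v = y u * y v + mixed (tlog y) u v.
Proof.
move=> uI vJ H; pose N := (size u + size v)%N; set kap := tlog y.
have kap0 : kap [::] = 0 by exact: tlog_nil.
(* [A w] has the divided powers of [kap] at [w] as coefficients, so [y w] is its value at 1 and
   [y u * y v] becomes a Cauchy product, to be matched with the binomial formula. *)
pose A w : {poly R} := \poly_(i < (size w).+1) ((i`!)%:R^-1 * tpow kap i w).
have AE w i : (A w)`_i = (i`!)%:R^-1 * tpow kap i w.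
  rewrite coef_poly; case: ltnP => // wi.
  by rewrite tpow_small ?mulr0.
have yE w : y w = (A w).[1].
  rewrite (horner_coef_wide _ (size_poly _ _)) (texp_tlog y1 (leqnn _)).
  by apply: eq_bigr => i _; rewrite expr1n mulr1 AE.
have sAB : (size (A u * A v)%R <= N.+1)%N.
  apply: (leq_trans (size_polyMleq _ _)).
  have sA w : (size (A w) <= (size w).+1)%N by exact: size_poly.
  have := leq_add (sA u) (sA v); rewrite addSn addnS.
  by case: (size (A u) + size (A v))%N => // c; rewrite ltnS.
rewrite (yE u) (yE v) -hornerM (horner_coef_wide _ sAB).
transitivity (\sum_(n < N.+1) (n`!)%:R^-1 * pair_sum (tpow kap n) u v).
  under [RHS]eq_bigr do rewrite /pair_sum big_distrr /=.
  rewrite exchange_big /=; apply: eq_big_seq => w /size_shuffle wN.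
  by rewrite (texp_tlog (N := N)) // wN.
under eq_bigr do rewrite (pair_sum_tpow (N := N) kap0 H) // mulrDr.
rewrite big_split /=; congr (_ + _).
  apply: eq_bigr => n _; rewrite expr1n mulr1 coefM big_distrr /=.
  apply: eq_bigr => m _; rewrite !AE.
  have mn : (m <= n)%N by rewrite -ltnS.
  rewrite -(bin_fact mn) !natrM.
  have f0 q : (q`!)%:R != 0 :> R by rewrite pnatr_eq0 -lt0n fact_gt0.
  have c0 : 'C(n, m)%:R != 0 :> R by rewrite pnatr_eq0 -lt0n bin_gt0.
  by field; rewrite !f0 c0.
(* The mixed term sits at n = 1, which is in range unless both words are empty, and then [mixed] is
   zero. *)
case: (boolP (N == 0)%N) => [|N0].
  rewrite addn_eq0 size_eq0 => /andP[/eqP u0 _].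
  by rewrite /mixed u0 /= big1 // => n _; rewrite !mulr0.
have N1 : (1 < N.+1)%N by rewrite ltnS lt0n.
rewrite (bigD1 (Ordinal N1)) //= invr1 !mul1r big1 ?addr0 // => n n1.
rewrite (_ : (n == 1%N :> nat) = false) ?mul0r ?mulr0 //.
by apply: contraNF n1 => /eqP n1; apply/eqP/val_inj.
Qed.

Lemma pair_sum_factor_of_tlog :
  (forall u v, in_star I u -> in_star J v -> pair_sum (tlog y) u v = 0) ->
  forall u v, in_star0 I u -> in_star0 J v -> pair_sum y u v = y u * y v.
Proof.
move=> H u v uI vJ; rewrite pair_sum_texp //; last by move=> u' v' *; exact: H.
rewrite /mixed; case: ifP => [/andP[u0 v0]|]; last by rewrite addr0.
by rewrite H ?addr0 //; apply/andP.
Qed.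

Lemma tlog_of_pair_sum_factor :
  (forall u v, in_star I u -> in_star J v -> pair_sum y u v = y u * y v) ->
  forall u v, in_star I u -> in_star J v -> pair_sum (tlog y) u v = 0.
Proof.
move=> H u v; move: {2}(size u + size v)%N (leqnn (size u + size v)) => n.
elim: n u v => [|n IH] u v uvn uI vJ.
  by move: uI uvn; rewrite leqn0 addn_eq0 !size_eq0 /in_star; case: eqP.
have [/andP[u0 uI'] /andP[v0 vJ']] := (uI, vJ).
have E : pair_sum y u v = y u * y v + mixed (tlog y) u v.
  apply: pair_sum_texp => // u' v' uI'' vJ'' lt; apply: IH => //.
  by rewrite -ltnS (leq_trans lt).
move/eqP: E; rewrite H // /mixed u0 v0 /= -subr_eq0 opprD addrA subrr sub0r.
by rewrite oppr_eq0 => /eqP.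
Qed.

End Factorisation.

End PairShuffles.

(** * Expectations of products under independence *)

Section ProductIntegrals.
Set Implicit Arguments.
Unset Strict Implicit.
Local Open Scope ereal_scope.

(** Integrability comes from Tonelli, where the iterated integral of absolute values splits into two
    finite factors; Fubini then gives the value. *)
Lemma product_integral d1 d2 (T1 : measurableType d1) (T2 : measurableType d2)
    (R : realType) (m1 : probability T1 R) (m2 : probability T2 R)
    (f : T1 -> R) (g : T2 -> R) :
  m1.-integrable setT (EFin \o f) -> m2.-integrable setT (EFin \o g) ->
  (m1 \x m2).-integrable setT (fun z => (f z.1 * g z.2)%:E) /\
  \int[m1 \x m2]_z (f z.1 * g z.2)%:E =
  \int[m1]_x (f x)%:E * \int[m2]_y (g y)%:E.
Proof.
move=> fi gi.
have mf : measurable_fun setT f by apply/measurable_EFinP; exact: measurable_int fi.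
have mg : measurable_fun setT g by apply/measurable_EFinP; exact: measurable_int gi.
have mh : measurable_fun setT (fun z : T1 * T2 => (f z.1 * g z.2)%:E).
  apply/measurable_EFinP/measurable_funM.
    exact: measurableT_comp mf measurable_fst.
  exact: measurableT_comp mg measurable_snd.
have intg (c : R) : \int[m2]_y (c * g y)%:E = c%:E * \int[m2]_y (g y)%:E.
  by under eq_integral do rewrite EFinM; rewrite integralZl.
have h : (m1 \x m2).-integrable setT (fun z => (f z.1 * g z.2)%:E).
  apply/integrable12ltyP => //=.
  have gf := integrable_fin_num measurableT (integrable_abse gi).
  rewrite [ltLHS](_ : _ = \int[m1]_x (`|(f x)%:E| * \int[m2]_y `|(g y)%:E|)).
    rewrite -(fineK gf) ge0_integralZr //; last 2 first.
    - exact: (measurable_int _ (integrable_abse fi)).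
    - by rewrite lee_fin; apply: fine_ge0; apply: integral_ge0 => x _; exact: abse_ge0.
    rewrite lte_mul_pinfty //.
    - by apply: integral_ge0 => x _; exact: abse_ge0.
    - exact: (integrable_fin_num measurableT (integrable_abse fi)).
    - by rewrite ltry.
  apply: eq_integral => x _.
  under eq_integral do rewrite normrM EFinM.
  by rewrite ge0_integralZl //; exact: (measurable_int _ (integrable_abse gi)).
split=> //; rewrite -(integral12_prod_meas1 h) /fubini_F /=.
under eq_integral do rewrite intg.
by rewrite -(fineK (integrable_fin_num measurableT gi)) integralZr.
Qed.

(** Independence makes the law of (U, V) the product of the marginal laws, by uniqueness of the
    product measure; both sides are then integrals over the plane. *)
Lemma integral_indep dO (Omega : measurableType dO) (R : realType)
    (P : probability Omega R) (U V : Omega -> R) :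
  P.-integrable setT (EFin \o U) -> P.-integrable setT (EFin \o V) ->
  P.-integrable setT (fun om => (U om * V om)%:E) ->
  (forall A B : set R, measurable A -> measurable B ->
     P ((U @^-1` A) `&` (V @^-1` B)) = P (U @^-1` A) * P (V @^-1` B)) ->
  \int[P]_om (U om * V om)%:E = \int[P]_om (U om)%:E * \int[P]_om (V om)%:E.
Proof.
move=> iU iV iUV indep.
have mU : measurable_fun setT U by apply/measurable_EFinP; exact: measurable_int iU.
have mV : measurable_fun setT V by apply/measurable_EFinP; exact: measurable_int iV.
have mW : measurable_fun setT (fun om => (U om, V om)) by exact: measurable_fun_pair.
pose U' : {mfun Omega >-> R} :=
  MeasurableFun.Pack (MeasurableFun.Class (isMeasurableFun.Build _ _ _ _ _ mU)).
pose V' : {mfun Omega >-> R} :=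
  MeasurableFun.Pack (MeasurableFun.Class (isMeasurableFun.Build _ _ _ _ _ mV)).
pose W' : {mfun Omega >-> (R * R)%type} :=
  MeasurableFun.Pack (MeasurableFun.Class (isMeasurableFun.Build _ _ _ _ _ mW)).
have mid : measurable_fun setT (EFin : R -> \bar R) by [].
have iidU : (distribution P U').-integrable setT (EFin \o (@id R)).
  exact: integrable_pushforward.
have iidV : (distribution P V').-integrable setT (EFin \o (@id R)).
  exact: integrable_pushforward.
have [_] := product_integral iidU iidV.
rewrite (integral_distribution (P := P) (X := U')) //.
rewrite (integral_distribution (P := P) (X := V')) // => <-.
rewrite -[LHS](integral_distribution (P := P) (X := W')
  (f := fun z : (R * R)%type => (z.1 * z.2)%:E)) //.
  apply: eq_measure_integral => A mA _; apply/esym.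
  by apply: product_measure_unique => // B C mB mC; exact: indep.
by apply/measurable_EFinP/measurable_funM.
Qed.

End ProductIntegrals.

(** * Cylinder sigma-algebras *)

Section GeneratedSigmaAlgebras.
Set Implicit Arguments.
Unset Strict Implicit.

(** The sets whose preimage lies in [H] form a sigma-algebra containing the generators. *)
Lemma sigma_algebra_preimage_gen (T T' : Type) (G : set (set T'))
    (H : set (set T)) (f : T -> T') :
  sigma_algebra setT H -> (forall C, G C -> H (f @^-1` C)) ->
  forall C, <<s G >> C -> H (f @^-1` C).
Proof.
move=> [H0 HC HU] GH C; apply: (smallest_sub (X := [set C | H (f @^-1` C)])) => //.
split=> /=; first by rewrite preimage_set0.
- by move=> A /HC; rewrite !setTD preimage_setC.
- by move=> A HA; rewrite preimage_bigcup; exact: HU.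
Qed.

Lemma sigma_algebra_setI (T : Type) (G : set (set T)) (A B : set T) :
  <<s G >> A -> <<s G >> B -> <<s G >> (A `&` B).
Proof.
have [h0 hC hU] := @smallest_sigma_algebra T setT G.
move=> hA hB; rewrite -[A `&` B]setCK setCI -setTD; apply: (hC _).
rewrite -bigcup2E; apply: hU => -[|[|n]] //=.
- by rewrite -setTD; apply: (hC _).
- by rewrite -setTD; apply: (hC _).
Qed.

Variables (R : realType) (d : nat).

Lemma cyl_sigma_coord (I : {set 'I_d}) (w : word d) (A : set R) :
  in_star I w -> measurable A -> cyl_sigma I [set y : tseries R d | A (y w)].
Proof. by move=> wI mA; apply: sub_gen_smallest; exists w, A. Qed.

Lemma cyl_sigma2_setI (I J : {set 'I_d}) (A B : set (tseries R d)) :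
  cyl_sigma I A -> cyl_sigma J B ->
  cyl_sigma2 I J ((fst @^-1` A) `&` (snd @^-1` B)).
Proof.
move=> IA JB; apply: sigma_algebra_setI.
- apply: sigma_algebra_preimage_gen IA; first exact: smallest_sigma_algebra.
  move=> _ [w [C [wI [mC ->]]]]; apply: sub_gen_smallest.
  by exists w, C; split=> //; left.
apply: sigma_algebra_preimage_gen JB; first exact: smallest_sigma_algebra.
move=> _ [w [C [wI [mC ->]]]]; apply: sub_gen_smallest.
by exists w, C; split=> //; right.
Qed.

Lemma cyl_sigma_measurable dO (Omega : measurableType dO)
    (S : Omega -> tseries R d) (I : {set 'I_d}) (A : set (tseries R d)) :
  (forall w, measurable_fun setT (fun om => S om w)) ->
  cyl_sigma I A -> measurable (S @^-1` A).
Proof.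
move=> mS; apply: sigma_algebra_preimage_gen.
  exact: sigma_algebra_measurable.
move=> _ [w [C [_ [mC ->]]]].
rewrite (_ : _ @^-1` _ = setT `&` (fun om => S om w) @^-1` C); last by rewrite setTI.
exact: mS.
Qed.

End GeneratedSigmaAlgebras.

(** * Signatures as characters of the shuffle algebra *)

Section Characters.
Set Implicit Arguments.
Unset Strict Implicit.
Variables (R : realType) (d : nat).

Definition is_character (s : tseries R d) : Prop :=
  s [::] = 1 /\ forall u v, pair_sum s u v = s u * s v.

Lemma signature_character (p : R) (x : roughpath d p) :
  is_character (signature x).
Proof.
have T0 := rp_T_ge0 x; split; first exact: rp_one.
move=> u v; have := rp_char (r := x) (lexx 0) T0 (lexx _) [:: (u, 1)] [:: (v, 1)].
rewrite /pairing /tshuffle /= cats0 big_map !big_seq1 /= !mul1r => <-.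
by apply: eq_bigr => w _; rewrite /= !mul1r.
Qed.

Lemma character_shuffle_all (s : tseries R d) (ts : seq (word d)) :
  is_character s -> \sum_(w <- shuffle_all ts) s w = \prod_(t <- ts) s t.
Proof.
move=> [s1 sM]; elim: ts => [|t ts IH]; first by rewrite big_seq1 big_nil.
rewrite /= big_flatten big_map big_cons -IH big_distrr /=.
by apply: eq_bigr => w _; rewrite -sM.
Qed.

End Characters.

(** * Expected signatures, moments and independence *)

Section ExpectedSignature.
Set Implicit Arguments.
Unset Strict Implicit.
Variables (R : realType) (d : nat) (dO : measure_display)
  (Omega : measurableType dO) (P : probability Omega R)
  (S : Omega -> tseries R d).
Hypothesis Schar : forall om, is_character (S om).
Hypothesis Sint : forall w, P.-integrable setT (fun om => (S om w)%:E).

Lemma character_nil om : S om [::] = 1.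
Proof. by case: (Schar om). Qed.

Lemma exp_sig_nil : exp_sig P S [::] = 1.
Proof.
rewrite /exp_sig /Ex; under eq_integral do rewrite character_nil.
by rewrite integral_cst //= probability_setT mul1e.
Qed.

Lemma integrable_sum_coef (l : seq (word d)) :
  P.-integrable setT (fun om => (\sum_(w <- l) S om w)%:E).
Proof.
rewrite (_ : (fun om => _) = fun om => (\sum_(w <- l) (S om w)%:E)%E).
  exact: integrable_sum.
by apply/funext => om; rewrite sumEFin.
Qed.

Lemma sum_exp_sig (l : seq (word d)) :
  \sum_(w <- l) exp_sig P S w = Ex P (fun om => \sum_(w <- l) S om w).
Proof.
elim: l => [|w l IH].
  rewrite big_nil /Ex; under eq_integral do rewrite big_nil.
  by rewrite integral0.
rewrite big_cons IH /exp_sig /Ex -fineD ?integrable_fin_num //; last first.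
  exact: integrable_sum_coef.
rewrite -integralD //; last exact: integrable_sum_coef.
by congr fine; apply: eq_integral => om _; rewrite big_cons EFinD.
Qed.

Lemma pair_sum_exp_sig u v : pair_sum (exp_sig P S) u v = Ex P (fun om => S om u * S om v).
Proof.
rewrite /pair_sum sum_exp_sig; congr Ex; apply/funext => om.
by case: (Schar om) => _ <-.
Qed.

(** The pathwise shuffle identity turns the product into a finite sum of integrable coordinates. *)
Lemma integrable_coefM u v :
  P.-integrable setT (fun om => (S om u * S om v)%:E).
Proof.
rewrite (_ : (fun om => _) = fun om => (\sum_(w <- shuffle u v) S om w)%:E).
  exact: integrable_sum_coef.
by apply/funext => om; case: (Schar om) => _ <-.
Qed.

(** The shuffle identity is applied under the expectation; the factors left out on the right belong
    to empty words and equal 1. *)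
Lemma shuffle_sum_exp_sig k (tau : 'I_k -> word d) (B : {set Ptau tau}) :
  shuffle_sum (exp_sig P S) B =
  Ex P (fun om => \prod_(j < k | blockword B j != [::]) S om (blockword B j)).
Proof.
rewrite shuffle_sumE sum_exp_sig; congr Ex; apply/funext => om.
rewrite character_shuffle_all // big_map big_enum [RHS]big_mkcond /=.
apply: eq_bigr => j _; case: eqP => //= ->; exact: character_nil.
Qed.

Lemma indep_restr_exp_sig (I J : {set 'I_d}) u v :
  indep_restr P S I J -> in_star I u -> in_star J v ->
  pair_sum (exp_sig P S) u v = exp_sig P S u * exp_sig P S v.
Proof.
move=> ind uI vJ; rewrite pair_sum_exp_sig /exp_sig /Ex -fineM ?integrable_fin_num //.
congr fine; apply: integral_indep;
  [exact: Sint|exact: Sint|exact: integrable_coefM|].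
by move=> A B mA mB; apply: (ind _ _ (cyl_sigma_coord uI mA) (cyl_sigma_coord vJ mB)).
Qed.

Lemma exp_sig_indep_restr (I J : {set 'I_d}) :
  (forall w, measurable_fun setT (fun om => S om w)) ->
  law_det_by_mixed_moments P S I J ->
  (forall u v, in_star0 I u -> in_star0 J v ->
     pair_sum (exp_sig P S) u v = exp_sig P S u * exp_sig P S v) ->
  indep_restr P S I J.
Proof.
move=> mS det fact A B IA JB.
have mSA : measurable (S @^-1` A) by exact: cyl_sigma_measurable IA.
have mSB : measurable (S @^-1` B) by exact: cyl_sigma_measurable JB.
have coord om w : coord1 (S om) w = S om w.
  by rewrite /coord1; case: eqP => // ->; rewrite character_nil.
have moments w1 w2 : in_star0 I w1 -> in_star0 J w2 ->
    (P \x P)%E.-integrable setT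
      (fun om => (coord1 (S om.1) w1 * coord1 (S om.2) w2)%:E) /\
    (\int[(P \x P)%E]_om (coord1 (S om.1) w1 * coord1 (S om.2) w2)%:E)%E =
    (\int[P]_om (S om w1 * S om w2)%:E)%E.
  move=> w1I w2J.
  have [h1 h2] := product_integral (Sint w1) (Sint w2).
  split; first by under eq_fun do rewrite !coord; exact: h1.
  under eq_integral do rewrite !coord.
  rewrite h2; have := fact _ _ w1I w2J; rewrite pair_sum_exp_sig /exp_sig /Ex => E.
  rewrite -[RHS]fineK ?integrable_fin_num ?E //; last exact: integrable_coefM.
  by rewrite EFinM !fineK ?integrable_fin_num.
(* The product of the probabilities is the mass of a rectangle under [P \x P], whose two coordinates
   carry independent copies of [S]; determinacy compares their joint law with that of (S, S). *)
rewrite -(product_measure1E P P mSA mSB); apply/esym.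
apply: (@det _ _ (P \x P)%E (fun om => S om.1) (fun om => S om.2) _ _ moments
  _ (cyl_sigma2_setI IA JB)) => w _.
  exact: measurableT_comp (mS w) measurable_fst.
exact: measurableT_comp (mS w) measurable_snd.
Qed.

End ExpectedSignature.

Theorem theorem3p6 (R : realType) (d : nat) (p : R)
  (dO : measure_display) (Omega : measurableType dO) (P : probability Omega R)
  (X : Omega -> roughpath d p) :
  1 <= p ->
  (* X is a random variable: its signature coordinates are measurable *)
  (forall w : word d, measurable_fun setT (fun om => signature (X om) w)) ->
  (* E |<X_{0,T}, f>| < oo for every f in T(V) *)
  (forall f : tensor R d,
     P.-integrable setT (fun om => (pairing (signature (X om)) f)%:E)) ->
  let S := fun om => signature (X om) in
  let mu := exp_sig P S in
  let kappa := sig_cumulant P S in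
  [/\ (* 1. compensated moments *)
      (forall (k : nat) (tau : 'I_k -> word d), (0 < k)%N ->
         (forall j, tau j != [::]) ->
         \sum_(w <- shuffle_all [seq tau j | j <- enum 'I_k]) kappa w =
         \sum_(a in Orp tau)
            (-1) ^+ (#|a|.-1) * ((ofact a)%:R / (#|a|)%:R) * gen_moment P S a),
      (* 2. moment bijection *)
      (forall tau : word d, tau != [::] ->
         mu tau =
         \sum_(a in Orp (fun _ : 'I_1 => tau))
            ((#|a|) `!)%:R^-1 * \prod_(B in a) kappa (blockword B ord0))
    & (* 3. independence *)
      (forall I J : {set 'I_d},
         law_det_by_mixed_moments P S I J ->
         (indep_restr P S I J <->
          (forall w1 w2, in_star I w1 -> in_star J w2 ->
             \sum_(w <- shuffle w1 w2) kappa w = 0)))].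
Proof.
move=> _ mS iS S mu kappa.
have Schar om : is_character (S om) by exact: signature_character.
have Sint w : P.-integrable setT (fun om => (S om w)%:E).
  have := iS [:: (w, 1)]; congr (_.-integrable _ _).
  by apply/funext => om; rewrite /pairing big_seq1 mul1r.
have mu1 : mu [::] = 1 by exact: exp_sig_nil.
split.
- move=> [//|k] tau _ tau0.
  rewrite /kappa /sig_cumulant shuffle_tlog //; last exact: card_Ptau_gt0 (tau0 ord0).
  apply: eq_bigr => a _; congr (_ * _); apply: eq_bigr => B _.
  exact: shuffle_sum_exp_sig.
- by move=> tau tau0; exact: texp_ordered_partitions.
move=> I J det; split=> [ind|kap0].
  by apply: tlog_of_pair_sum_factor => // u v uI vJ; exact: indep_restr_exp_sig ind _ _.
by apply: exp_sig_indep_restr => //; exact: pair_sum_factor_of_tlog.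
Qed.
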